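(* Let $\mathbf{k}$ be an algebraically closed field of characteristic different from $2$ and $3$, let $\tau$ be a positive integer, and let $\mathcal{H}=\langle 6,2+6\tau,3+6\tau,4+6\tau,5+6\tau\rangle$. Let $\mathcal{Q}_{\mathcal{H}}$ be the quadratic quasi-cone of $\mathcal{H}$ (see context), and let $\mathrm{A}:=\mathbf{k}[\varepsilon]=\bigoplus_{j=0}^{\tau-1}\mathbf{k}\,\varepsilon^j$, where $\varepsilon^\tau=0$. Then $\mathcal{Q}_{\mathcal{H}}$ is isomorphic to the direct product $$\mathcal{Q}_{\mathcal{H}}=V\times W,$$ where $V$ is the $(\tau+6)$-dimensional weighted vector space with the weights $1,2,3,4,4,6$ and $6i$ $(i=1,\dots,\tau)$, and where $W$ is the quasi-cone consisting of the vectors $$(\omega_1,\dots,\omega_{10})=\Big(\sum_{j=0}^{\tau-1}w_{1j}\varepsilon^j,\dots,\sum_{j=0}^{\tau-1}w_{10,j}\varepsilon^j\Big)\in\mathrm{A}^{10}$$ satisfying the five equations $$\begin{aligned} \omega_1\omega_9+\omega_5\omega_6-\omega_2\omega_{10}&=0,\\ \omega_4\omega_{10}+\omega_3\omega_9-\omega_6\omega_7&=0,\\ \omega_1\omega_4+\omega_2\omega_3+\omega_6\omega_8&=0,\\ \omega_8\omega_{10}+\omega_3\omega_5+\omega_1\omega_7&=0,\\ \omega_2\omega_7+\omega_8\omega_9-\omega_4\omega_5&=0 \end{aligned}$$ in the artinian algebra $\mathrm{A}$. To the coefficients $w_{ij}$ are attached the weights $\eta_i+6(\tau-j)$, where $(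\eta_1,\dots,\eta_{10})=(1,1,2,2,3,4,4,-1,6,6)$.
   Context: Definition of $\mathcal{Q}_{\mathcal{H}}$. Consider unknown coefficients $g_{ir}$, $f_{ir}$ of weight $r$, arranged as polynomials in one variable $t$: for each residue $j\in\{1,\dots,6\}$, the partial polynomial $g_i^{(j)}=\sum_{r\equiv j\bmod 6}g_{ir}t^r$ (similarly $f_i^{(j)}$), where $r$ runs over the positive integers $\equiv j \bmod 6$ not larger than the formal degree of the partial polynomial. Put $$\begin{aligned} g_4&=g_4^{(1)}+g_4^{(2)}+g_4^{(4)}+g_4^{(5)}+g_4^{(6)}, & f_6&=f_6^{(1)}+f_6^{(3)}+f_6^{(4)}+f_6^{(6)},\\ g_5&=g_5^{(1)}+g_5^{(2)}+g_5^{(3)}+g_5^{(5)}+g_5^{(6)}, & f_8&=f_8^{(2)}+f_8^{(4)}+f_8^{(5)}+f_8^{(6)},\\ g_6&=g_6^{(1)}+g_6^{(2)}+g_6^{(3)}+g_6^{(4)}+g_6^{(6)}, & f_9&=f_9^{(1)}+f_9^{(3)}+f_9^{(6)},\\ g_7&=g_7^{(1)}+g_7^{(2)}+g_7^{(3)}+g_7^{(4)}+g_7^{(5)}, & f_{10}&=f_{10}^{(1)}+f_{10}^{(2)}+f_{10}^{(4)}+f_{10}^{(5)}+f_{10}^{(6)},\\ g_8&=g_8^{(2)}+g_8^{(3)}+g_8^{(4)}+g_8^{(5)}+g_8^{(6)}. \end{aligned}$$ Formal degrees: $g_4^{(4)},g_5^{(5)},g_6^{(6)},f_6^{(6)},g_7^{(1)},g_8^{(2)},f_8^{(2)},f_9^{(3)},f_{10}^{(4)}$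 have formal degree $i+12\tau$ ($i$ the lower index); $g_4^{(5)},g_4^{(6)},g_5^{(6)}$ have formal degree $j+6(\tau-1)$; $f_9^{(1)},f_{10}^{(1)},f_{10}^{(2)}$ have formal degree $j+6(\tau+1)$; the remaining 26 partial polynomials have formal degree $j+6\tau$. Moreover $g_{41}=g_{42}=g_{46}=0$. This leaves $50\tau+43$ unknown coefficients, subject to the following five polynomial identities in $t$: $$\begin{aligned} g_4-f_6+g_8&=f_6^{(1)}f_9+f_6^{(3)}g_7+(f_6^{(4)}-g_8^{(4)})f_6-g_8^{(5)}g_5-g_8^{(6)}g_4,\\ g_5-f_6+f_9&=f_6^{(1)}f_{10}+f_6^{(3)}f_8-f_9^{(6)}g_5-f_9^{(1)}g_4,\\ g_6-f_6-f_8+f_9&=f_8^{(4)}g_8+f_8^{(5)}g_7-f_9^{(6)}g_6+f_8^{(6)}f_6-f_9^{(1)}g_5,\\ g_7-f_8+f_{10}&=f_8^{(4)}f_9+(f_8^{(5)}-f_{10}^{(5)})f_8-f_{10}^{(6)}g_7-f_{10}^{(1)}g_6-f_{10}^{(2)}g_5,\\ g_8-f_8-f_9+f_{10}&=f_9^{(6)}f_8-f_{10}^{(5)}f_9-f_{10}^{(6)}g_8-f_{10}^{(1)}g_7-f_{10}^{(2)}f_6. \end{aligned}$$ Comparing coefficients of powers of $t$ gives a system of quasi-homogeneous polynomial equations $\varrho_j=0$ in the $50\tau+43$ coefficients, where $\varrho_j=\varrho_j^{(1)}+\varrho_j^{(2)}$ (linear plus quadratic part). (Up to the $\mathbb{G}_m$-action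 $g_{ij}\mapsto c^jg_{ij}$, $f_{ij}\mapsto c^jf_{ij}$, its solutions parametrize the pointed complete integral Gorenstein curves with Weierstrass semigroup $\mathcal{H}$.) Let $\mathcal{T}_{\mathcal{H}}$ be the weighted vector space defined by the linear equations $\varrho_j^{(1)}=0$ for all $j$. Solve these linear equations for as many coefficients as possible in terms of the remaining ones, which become coordinates on $\mathcal{T}_{\mathcal{H}}$; by quasi-homogeneity the same coefficients can be eliminated from as many of the polynomial equations $\varrho_j=0$, and substituting into the other equations one gets quasi-homogeneous polynomials $h_j$ on $\mathcal{T}_{\mathcal{H}}$ without linear terms. Then $\mathcal{Q}_{\mathcal{H}}\subseteq\mathcal{T}_{\mathcal{H}}$ is the common zero locus of the homogeneous components $h_j^{(2)}$ of degree 2 of the $h_j$. ''Quasi-cone'' means a closed subset of a weighted vector space cut out by quasi-homogeneous equations. *)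

(* Defs.v *)
From HB Require Import structures.
From mathcomp Require Import all_boot all_order all_algebra.
From mathcomp Require Export mpoly.

Set Implicit Arguments.
Unset Strict Implicit.
Unset Printing Implicit Defensive.

Import GRing.Theory.
Local Open Scope ring_scope.

(* A weighted vector space is given by coordinates: a finite type I of
   coordinates and a weight function wt : I -> int; its points are the families
   {ffun I -> k}, and its polynomial functions are the elements of
   {mpoly k[#|I|]}, the a-th variable being the coordinate enum_val a. *)

Definition coord_poly (k : fieldType) (I : finType) (i : I) :
  {mpoly k[#|I|]} := 'X_(enum_rank i).

Definition coord_eval (k : fieldType) (I : finType) (p : {mpoly k[#|I|]})
    (x : {ffun I -> k}) : k :=
  p.@[fun a => x (enum_val a)].

Definition quasi_homogeneous (k : fieldType) (I : finType) (wt : I -> int)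
    (d : int) (p : {mpoly k[#|I|]}) : Prop :=
  forall m, m \in msupp p -> \sum_(i : I) wt i *+ m (enum_rank i) = d.

Definition poly_map (k : fieldType) (I J : finType)
    (phi : J -> {mpoly k[#|I|]}) (x : {ffun I -> k}) : {ffun J -> k} :=
  [ffun j => coord_eval (phi j) x].

(* Isomorphism of quasi-cones X and Y: mutually inverse bijections that are
   restrictions of polynomial maps of the ambient weighted vector spaces
   respecting the weights (equivalently, commuting with the action of the
   multiplicative group). *)
Definition quasi_cone_iso (k : fieldType) (I J : finType)
    (wtI : I -> int) (X : {ffun I -> k} -> Prop)
    (wtJ : J -> int) (Y : {ffun J -> k} -> Prop) : Prop :=
  exists (phi : J -> {mpoly k[#|I|]}) (psi : I -> {mpoly k[#|J|]}),
  [/\ forall j, quasi_homogeneous wtI (wtJ j) (phi j),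
      forall i, quasi_homogeneous wtJ (wtI i) (psi i),
      forall x, X x -> Y (poly_map phi x) /\ poly_map psi (poly_map phi x) = x
    & forall y, Y y -> X (poly_map psi y) /\ poly_map phi (poly_map psi y) = y].

(* A triple (s, i, r) denotes the coefficient g_{ir} if s = false and f_{ir} if
   s = true; a triple (s, i, j) with 1 <= j <= 6 also denotes the partial
   polynomial g_i^{(j)} or f_i^{(j)}. *)
Definition ltr_g : bool := false.
Definition ltr_f : bool := true.

Definition partials : seq (bool * nat * nat) :=
  [seq (u.1, j) | u <-
    [:: ((ltr_g, 4), [:: 1; 2; 4; 5; 6]);
        ((ltr_g, 5), [:: 1; 2; 3; 5; 6]);
        ((ltr_g, 6), [:: 1; 2; 3; 4; 6]);
        ((ltr_g, 7), [:: 1; 2; 3; 4; 5]);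
        ((ltr_g, 8), [:: 2; 3; 4; 5; 6]);
        ((ltr_f, 6), [:: 1; 3; 4; 6]);
        ((ltr_f, 8), [:: 2; 4; 5; 6]);
        ((ltr_f, 9), [:: 1; 3; 6]);
        ((ltr_f, 10), [:: 1; 2; 4; 5; 6])], j <- u.2]%N.

Definition formal_degree (tau : nat) (u : bool * nat * nat) : nat :=
  let: (_, i, j) := u in
  if u \in [:: (ltr_g, 4, 4); (ltr_g, 5, 5); (ltr_g, 6, 6); (ltr_f, 6, 6);
               (ltr_g, 7, 1); (ltr_g, 8, 2); (ltr_f, 8, 2); (ltr_f, 9, 3);
               (ltr_f, 10, 4)]%N then (i + 12 * tau)%N
  else if u \in [:: (ltr_g, 4, 5); (ltr_g, 4, 6); (ltr_g, 5, 6)]%N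
  then (j + 6 * (tau - 1))%N
  else if u \in [:: (ltr_f, 9, 1); (ltr_f, 10, 1); (ltr_f, 10, 2)]%N
  then (j + 6 * (tau + 1))%N
  else (j + 6 * tau)%N.

Definition coefs (tau : nat) : seq (bool * nat * nat) :=
  [seq v <- [seq (u.1, r) | u <- partials,
              r <- [seq r <- iota 1 (formal_degree tau u) | r == u.2 %[mod 6]]]
   | v \notin [:: (ltr_g, 4, 1); (ltr_g, 4, 2); (ltr_g, 4, 6)]]%N.

Fact coefs_count_small :
  all (fun tau => uniq (coefs tau) && (size (coefs tau) == 50 * tau + 43)%N)
      (iota 1 6).
Proof. by vm_compute. Qed.

Definition coef (tau : nat) : finType := seq_sub (coefs tau).

Definition coef_wt (tau : nat) (c : coef tau) : int := (ssval c).2%:Z.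

Definition coef_var (k : fieldType) (tau : nat) (v : bool * nat * nat) :
    {mpoly k[#|coef tau|]} :=
  if insub v is Some c then coord_poly k (c : coef tau) else 0.

(* coef_var is 0 on triples outside coefs tau, and all formal degrees are at most
   12 * tau + 10. *)
Definition partial_poly (k : fieldType) (tau : nat) (s : bool) (i j : nat) :
    {poly {mpoly k[#|coef tau|]}} :=
  \sum_(r < 12 * tau + 11 | r == j %[mod 6])
    (coef_var k tau (s, i, nat_of_ord r))%:P * 'X^r.

Definition full_poly (k : fieldType) (tau : nat) (s : bool) (i : nat) :
    {poly {mpoly k[#|coef tau|]}} :=
  \sum_(u <- partials | u.1 == (s, i)) partial_poly k tau s i u.2.

Definition relations (k : fieldType) (tau : nat) :
    5.-tuple {poly {mpoly k[#|coef tau|]}} :=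
  let g := full_poly k tau ltr_g in
  let f := full_poly k tau ltr_f in
  let gp := partial_poly k tau ltr_g in
  let fp := partial_poly k tau ltr_f in
  [tuple
    (g 4%N - f 6%N + g 8%N)
    - (fp 6%N 1%N * f 9%N + fp 6%N 3%N * g 7%N + (fp 6%N 4%N - gp 8%N 4%N) * f 6%N
       - gp 8%N 5%N * g 5%N - gp 8%N 6%N * g 4%N);
    (g 5%N - f 6%N + f 9%N)
    - (fp 6%N 1%N * f 10%N + fp 6%N 3%N * f 8%N - fp 9%N 6%N * g 5%N - fp 9%N 1%N * g 4%N);
    (g 6%N - f 6%N - f 8%N + f 9%N)
    - (fp 8%N 4%N * g 8%N + fp 8%N 5%N * g 7%N - fp 9%N 6%N * g 6%N + fp 8%N 6%N * f 6%N
       - fp 9%N 1%N * g 5%N);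
    (g 7%N - f 8%N + f 10%N)
    - (fp 8%N 4%N * f 9%N + (fp 8%N 5%N - fp 10%N 5%N) * f 8%N - fp 10%N 6%N * g 7%N
       - fp 10%N 1%N * g 6%N - fp 10%N 2%N * g 5%N);
    (g 8%N - f 8%N - f 9%N + f 10%N)
    - (fp 9%N 6%N * f 8%N - fp 10%N 5%N * f 9%N - fp 10%N 6%N * g 8%N - fp 10%N 1%N * g 7%N
       - fp 10%N 2%N * f 6%N)].

(* An equation is the coefficient of a power of t in one of the relations. *)
Definition equation (k : fieldType) (tau : nat) : finType :=
  ('I_5 * 'I_(\max_(i < 5) size (tnth (relations k tau) i))%N)%type.

Definition rho (k : fieldType) (tau : nat) (e : equation k tau) :
    {mpoly k[#|coef tau|]} :=
  (tnth (relations k tau) e.1)`_e.2.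

Definition T_H (k : fieldType) (tau : nat) (x : {ffun coef tau -> k}) : Prop :=
  forall e : equation k tau, coord_eval (pihomog mdeg 1 (rho e)) x = 0.

Definition lin_mx (k : fieldType) (tau : nat) :
    'M[k]_(#|equation k tau|, #|coef tau|) :=
  \matrix_(a, b) (rho (enum_val a))@_(U_(b)).

(* A choice of a maximal set of coefficients piv that can be eliminated by means
   of the equations eqs, together with the resulting expression sol of all
   coefficients as polynomials in the remaining ones. *)
Record elimination (k : fieldType) (tau : nat) : Type := Elimination {
  piv : 'I_(\rank (lin_mx k tau)) -> coef tau;
  eqs : 'I_(\rank (lin_mx k tau)) -> equation k tau;
  sol : coef tau -> {mpoly k[#|coef tau|]};
  elim_unit :
    \matrix_(a, b) lin_mx k tau (enum_rank (eqs a)) (enum_rank (piv b))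
      \in unitmx;
  sol_free : forall c, (forall b, piv b <> c) -> sol c = coord_poly k c;
  sol_piv_vars : forall b m, m \in msupp (sol (piv b)) ->
    forall b', m (enum_rank (piv b')) = 0%N;
  sol_homog : forall c, quasi_homogeneous (@coef_wt tau) (coef_wt c) (sol c);
  sol_eqs : forall a,
    rho (eqs a) \mPo [tuple sol (enum_val i) | i < #|coef tau|] = 0 }.

Definition h_poly (k : fieldType) (tau : nat) (E : elimination k tau)
    (e : equation k tau) : {mpoly k[#|coef tau|]} :=
  rho e \mPo [tuple sol E (enum_val i) | i < #|coef tau|].

Definition Q_H (k : fieldType) (tau : nat) (E : elimination k tau)
    (x : {ffun coef tau -> k}) : Prop :=
  T_H x /\
  forall e : equation k tau, (forall a, eqs E a <> e) ->
    coord_eval (pihomog mdeg 2 (h_poly E e)) x = 0.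

(* The artinian algebra A = k[t]/(t^tau), for tau > 0. *)
Definition artA (k : fieldType) (tau : nat) := {poly %/ ('X^tau : {poly k})}.

Definition eps (k : fieldType) (tau : nat) : artA k tau :=
  in_qpoly 'X^tau 'X.

(* Coordinates are numbered from 0: index (i, j) of the second summand stands
   for w_{i+1,j}. *)
Definition VW_ix (tau : nat) : finType :=
  (('I_6 + 'I_tau) + 'I_10 * 'I_tau)%type.

Definition eta_wt : seq int := [:: 1; 1; 2; 2; 3; 4; 4; -1; 6; 6].

Definition VW_wt (tau : nat) (c : VW_ix tau) : int :=
  match c with
  | inl (inl i) => nth 0 [:: 1; 2; 3; 4; 4; 6] i
  | inl (inr i) => 6 * (i.+1)%:Z
  | inr (i, j) => nth 0 eta_wt i + 6 * (tau%:Z - j%:Z)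
  end.

Definition omega (k : fieldType) (tau : nat) (w : 'I_10 * 'I_tau -> k)
    (i : nat) : artA k tau :=
  \sum_(j < tau) w (inord i.-1, j) *: eps k tau ^+ j.

Definition W_cone (k : fieldType) (tau : nat) (w : 'I_10 * 'I_tau -> k) :
    Prop :=
  let om := omega w in
  [/\ om 1%N * om 9%N + om 5%N * om 6%N - om 2%N * om 10%N = 0,
      om 4%N * om 10%N + om 3%N * om 9%N - om 6%N * om 7%N = 0,
      om 1%N * om 4%N + om 2%N * om 3%N + om 6%N * om 8%N = 0,
      om 8%N * om 10%N + om 3%N * om 5%N + om 1%N * om 7%N = 0
    & om 2%N * om 7%N + om 8%N * om 9%N - om 4%N * om 5%N = 0].

(* V is the whole weighted vector space spanned by the first summand of
   VW_ix. *)
Definition VW (k : fieldType) (tau : nat) (x : {ffun VW_ix tau -> k}) : Prop :=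
  W_cone (fun ij => x (inr ij)).

(* Main.v *)
(* A coefficient vector decomposes into columns indexed by a letter g_i or f_i and
   a residue j mod 6, the column being the polynomial in t^6 that multiplies t^j.
   Write L for the linear and Q for the quadratic part of the equations.
   Whatever elimination is chosen, Q_H is the set of x in ker L such that Q(x) lies
   in the image of L: the degree-2 components of the eliminated coefficients form a
   solution y of L(y) = Q(x) as soon as one exists.  Solving the linear
   equations column by column describes ker L by eleven free polynomials.  For x
   in ker L, the equation L(y) = Q(x) can be solved degree by degree, except that
   the formal degrees bound the columns of y; the only surviving conditions are that
   five quadratic polynomials in the parameters have degree at most tau in t^6.
   Sending t^(6m) to eps^(tau - m) identifies these top coefficients with the five
   equations of W in A; the constant terms and one more column, which never enter
   them, are the coordinates on V.  The resulting isomorphism is linear. *)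
From HB Require Import structures.
Require Import Defs.
From mathcomp Require Import all_boot all_order all_algebra.
From mathcomp Require Import ring zify.
Set Implicit Arguments.
Unset Strict Implicit.
Unset Printing Implicit Defensive.
Import GRing.Theory.
Local Open Scope ring_scope.

(** * Weighted gradings *)

Section WeightedMeasure.
Variables (I : finType) (wt : I -> nat).

(** With weights in [nat], [wdeg] is a [measure], so weighted homogeneity becomes
    [d.-homog for wdeg]. *)
Definition wdeg (m : 'X_{1..#|I|}) : nat :=
  (\sum_(i : I) wt i * m (enum_rank i))%N.

Lemma wdeg0 : wdeg 0%MM = 0%N.
Proof. by apply: big1 => i _; rewrite mnm0E muln0. Qed.

Lemma wdegD : {morph wdeg : m1 m2 / (m1 + m2)%MM >-> (m1 + m2)%N}.
Proof.
by move=> m1 m2; rewrite -big_split; apply: eq_bigr => i _; rewrite mnmDE mulnDr.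
Qed.

HB.instance Definition _ := isMeasure.Build #|I| wdeg wdeg0 wdegD.

Lemma wdegU a : wdeg U_(a)%MM = wt (enum_val a).
Proof.
rewrite /wdeg (bigD1 (enum_val a)) //= mnm1E enum_valK eqxx muln1.
rewrite big1 ?addn0 // => j ji; rewrite mnm1E; case: eqP => [ae|_]; last lia.
by case/eqP: ji; rewrite ae enum_rankK.
Qed.

Variable k : fieldType.
Implicit Types p : {mpoly k[#|I|]}.

Lemma quasi_homogeneous_wdeg d p :
  quasi_homogeneous (fun i => (wt i)%:Z) d%:Z p <-> p \is d.-homog for wdeg.
Proof.
have E (m : 'X_{1..#|I|}) : \sum_i (wt i)%:Z *+ m (enum_rank i) = (wdeg m)%:Z.
  rewrite /wdeg -[RHS]natz natr_sum; apply: eq_bigr => i _.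
  by rewrite natrM mulr_natr natz.
split.
  by move=> h; apply/dhomogP => m /h; rewrite E => -[].
by move/dhomogP => h m /h <-; apply: E.
Qed.

Lemma coord_poly_wdeg (i : I) : coord_poly k i \is (wt i).-homog for wdeg.
Proof. by rewrite dhomogX /= wdegU enum_rankK. Qed.

(** The target measure [mf] is arbitrary: the lemma serves for the weights and also for a degree
    that counts only the eliminated variables. *)
Lemma comp_mpoly_dhomog n (mf : measure n) d p
    (t : #|I|.-tuple {mpoly k[n]}) :
    p \is d.-homog for wdeg ->
    (forall a, tnth t a \is (wt (enum_val a)).-homog for mf) ->
  p \mPo t \is d.-homog for mf.
Proof.
move=> /dhomogP hp ht; rewrite comp_mpolyE big_seq.
apply: rpred_sum => m /hp <-; apply: rpredZ.
rewrite mfE; apply: (big_ind2 (fun q e => q \is e.-homog for mf)).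
- exact: dhomog1.
- by move=> p1 d1 p2 d2; apply: dhomogM.
- by move=> a _; rewrite mulnC /= wdegU; apply: dhomogMn.
Qed.

(** Homogeneous of degree [d] in the unknowns, and quasi-homogeneous with the exponent of [t] as
    weight. Both gradings propagate from the partial polynomials to all relations. *)
Definition bigraded d (P : {poly {mpoly k[#|I|]}}) : Prop :=
  forall r, P`_r \is d.-homog /\ P`_r \is r.-homog for wdeg.

Lemma bigradedD d P Q : bigraded d P -> bigraded d Q -> bigraded d (P + Q).
Proof.
move=> hP hQ r; have [P1 P2] := hP r; have [Q1 Q2] := hQ r.
by rewrite coefD; split; apply: rpredD.
Qed.

Lemma bigradedN d P : bigraded d P -> bigraded d (- P).
Proof. by move=> hP r; have [P1 P2] := hP r; rewrite coefN !rpredN. Qed.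

Lemma bigradedM d e P Q :
  bigraded d P -> bigraded e Q -> bigraded (d + e) (P * Q).
Proof.
move=> hP hQ r; rewrite coefM; split; apply: rpred_sum => i _.
  by apply: dhomogM; [case: (hP i) | case: (hQ (r - i)%N)].
have /dhomogM/(_ (proj2 (hQ (r - i)%N))) := proj2 (hP i).
by rewrite subnKC // leq_ord.
Qed.

Lemma bigraded_sum d (J : Type) (s : seq J) (p : pred J) F :
  (forall j, bigraded d (F j)) -> bigraded d (\sum_(j <- s | p j) F j).
Proof.
move=> hF; elim/big_rec: _ => [|j P _ hP]; last exact: bigradedD.
by move=> r; rewrite coef0; split; apply: rpred0.
Qed.

End WeightedMeasure.

Lemma dhomog1_linear n (R : nzRingType) (p : {mpoly R[n]}) :
  p \is 1.-homog -> p = \sum_i p@_U_(i) *: 'X_i.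
Proof.
move=> hp; apply/mpolyP => m; rewrite raddf_sum /=.
under eq_bigr do rewrite mcoeffZ mcoeffX.
have [/mdeg1P[i /eqP ->]|m1] := boolP (mdeg m == 1%N).
  rewrite (bigD1 i) //= eqxx mulr1 big1 ?addr0 // => j ji.
  by rewrite eq_mnm1 (negPf ji) mulr0.
rewrite (dhomog_nemf_coeff hp) // big1 // => i _.
by case: eqP => [mE|_]; rewrite ?mulr0 //; rewrite -mE mdeg1 in m1.
Qed.

Lemma pihomog_lin_quad n (R : nzRingType) (p l q : {mpoly R[n]}) :
  p = l - q -> l \is 1.-homog -> q \is 2.-homog ->
  pihomog mdeg 1 p = l /\ pihomog mdeg 2 p = - q.
Proof.
move=> -> hl hq; rewrite !pihomogB (pihomog_dE hl) (pihomog_dE hq).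
by rewrite (pihomog_ne0 _ hq) // (pihomog_ne0 _ hl) // subr0 sub0r.
Qed.

(** * Linear and quadratic parts of the equations *)

Section Relations.
Variables (k : fieldType) (tau : nat).

Definition coef_deg (c : coef tau) : nat := (ssval c).2.

Lemma coef_wtE c : coef_wt c = (coef_deg c)%:Z. Proof. by []. Qed.

(** Stated over any ring, because the same expressions are used for polynomials in the unknowns, for
    their values at a point and for single columns. *)
Definition linear_part (P : nzRingType) (g f : nat -> P) : 5.-tuple P :=
  [tuple g 4%N - f 6%N + g 8%N;
         g 5%N - f 6%N + f 9%N;
         g 6%N - f 6%N - f 8%N + f 9%N;
         g 7%N - f 8%N + f 10%N;
         g 8%N - f 8%N - f 9%N + f 10%N].

Definition quadratic_part (P : nzRingType) (g f : nat -> P)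
    (gp fp : nat -> nat -> P) : 5.-tuple P :=
  [tuple
    fp 6%N 1%N * f 9%N + fp 6%N 3%N * g 7%N + (fp 6%N 4%N - gp 8%N 4%N) * f 6%N
       - gp 8%N 5%N * g 5%N - gp 8%N 6%N * g 4%N;
    fp 6%N 1%N * f 10%N + fp 6%N 3%N * f 8%N - fp 9%N 6%N * g 5%N - fp 9%N 1%N * g 4%N;
    fp 8%N 4%N * g 8%N + fp 8%N 5%N * g 7%N - fp 9%N 6%N * g 6%N + fp 8%N 6%N * f 6%N
       - fp 9%N 1%N * g 5%N;
    fp 8%N 4%N * f 9%N + (fp 8%N 5%N - fp 10%N 5%N) * f 8%N - fp 10%N 6%N * g 7%N
       - fp 10%N 1%N * g 6%N - fp 10%N 2%N * g 5%N;
    fp 9%N 6%N * f 8%N - fp 10%N 5%N * f 9%N - fp 10%N 6%N * g 8%N - fp 10%N 1%N * g 7%N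
       - fp 10%N 2%N * f 6%N].

Definition lin_rel := linear_part (full_poly k tau ltr_g) (full_poly k tau ltr_f).
Definition quad_rel :=
  quadratic_part (full_poly k tau ltr_g) (full_poly k tau ltr_f)
    (partial_poly k tau ltr_g) (partial_poly k tau ltr_f).

Lemma I5P (P : 'I_5 -> Prop) :
  P (inord 0) -> P (inord 1) -> P (inord 2) -> P (inord 3) -> P (inord 4) ->
  forall i, P i.
Proof.
by move=> P0 P1 P2 P3 P4 i; rewrite -(inord_val i); case: i => [[|[|[|[|[|i]]]]] hi].
Qed.

Lemma relationsE i : tnth (relations k tau) i = tnth lin_rel i - tnth quad_rel i.
Proof. by elim/I5P: i; rewrite !(tnth_nth 0) !inordK. Qed.

Lemma partial_bigraded s i j :
  bigraded coef_deg 1 (partial_poly k tau s i j).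
Proof.
apply: bigraded_sum => r n; rewrite mul_polyC coefZ coefXn.
have [<-|_] := eqVneq n r; last by rewrite mulr0; split; apply: rpred0.
rewrite mulr1 /coef_var; case: insubP => [c _ cE|_]; last by split; apply: rpred0.
split; first by rewrite dhomogX /= mdeg1.
by have := coord_poly_wdeg coef_deg k c; rewrite /coef_deg cE.
Qed.

Lemma full_bigraded s i : bigraded coef_deg 1 (full_poly k tau s i).
Proof. by apply: bigraded_sum => u; apply: partial_bigraded. Qed.

Lemma lin_rel_bigraded i : bigraded coef_deg 1 (tnth lin_rel i).
Proof.
elim/I5P: i; rewrite !(tnth_nth 0) !inordK //=.
all: by do ?[apply: bigradedD | apply: bigradedN | apply: full_bigraded].
Qed.

Lemma quad_rel_bigraded i : bigraded coef_deg 2 (tnth quad_rel i).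
Proof.
have M := @bigradedM _ coef_deg k 1 1.
elim/I5P: i; rewrite !(tnth_nth 0) !inordK //=.
all: by do ?[apply: full_bigraded | apply: partial_bigraded
            | apply: bigradedD | apply: bigradedN | apply: M].
Qed.

Implicit Type e : equation k tau.

Lemma rhoE e : rho e = (tnth lin_rel e.1)`_e.2 - (tnth quad_rel e.1)`_e.2.
Proof. by rewrite /rho relationsE coefB. Qed.

Lemma pihomog1_rho e : pihomog mdeg 1 (rho e) = (tnth lin_rel e.1)`_e.2.
Proof.
have [l1 _] := lin_rel_bigraded e.1 e.2; have [q1 _] := quad_rel_bigraded e.1 e.2.
by have [] := pihomog_lin_quad (rhoE e) l1 q1.
Qed.

Lemma pihomog2_rho e : pihomog mdeg 2 (rho e) = - (tnth quad_rel e.1)`_e.2.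
Proof.
have [l1 _] := lin_rel_bigraded e.1 e.2; have [q1 _] := quad_rel_bigraded e.1 e.2.
by have [] := pihomog_lin_quad (rhoE e) l1 q1.
Qed.

Lemma rho_split e : rho e = pihomog mdeg 1 (rho e) + pihomog mdeg 2 (rho e).
Proof. by rewrite pihomog1_rho pihomog2_rho rhoE. Qed.

Lemma rho1_wdeg e : pihomog mdeg 1 (rho e) \is (e.2 : nat).-homog for (wdeg coef_deg).
Proof. by rewrite pihomog1_rho; case: (lin_rel_bigraded e.1 e.2). Qed.

Lemma rho2_wdeg e : pihomog mdeg 2 (rho e) \is (e.2 : nat).-homog for (wdeg coef_deg).
Proof. by rewrite pihomog2_rho rpredN; case: (quad_rel_bigraded e.1 e.2). Qed.

(** Positivity of the weights makes the elimination below terminate and excludes constant terms from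
    its solution. *)
Lemma coef_deg_gt0 (c : coef tau) : (0 < coef_deg c)%N.
Proof.
have := ssvalP c; rewrite /coefs mem_filter => /andP[_ /allpairsPdep[u [r []]]].
by rewrite /coef_deg mem_filter mem_iota => _ /and3P[_ r0 _] ->.
Qed.

End Relations.

(** * Existence of eliminations *)

Lemma unitmx_inj (F : fieldType) (I J : Type) r
    (A : I -> J -> F) (f : 'I_r -> I) (g : 'I_r -> J) :
  \matrix_(a, b) A (f a) (g b) \in unitmx -> injective g.
Proof.
set M := \matrix_(_, _) _ => Mu b b' gbb'.
have colM : M *m delta_mx b (0 : 'I_1) = M *m delta_mx b' 0.
  by rewrite -!colE; apply/colP => a; rewrite !mxE gbb'.
have /colP/(_ b) := can_inj (mulKmx Mu) colM.
rewrite !mxE !eqxx /=; case: eqP => // _ /eqP; by rewrite oner_eq0.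
Qed.

Lemma rowsub_submx (F : fieldType) m n r (A : 'M[F]_(m, n)) (f : 'I_r -> 'I_m) :
  (rowsub f A <= A)%MS.
Proof.
apply/row_subP => i; apply/submxP; exists (delta_mx 0 (f i)).
by rewrite -rowE; apply/rowP => j; rewrite !mxE.
Qed.

Lemma maximal_minor (F : fieldType) m n (A : 'M[F]_(m, n)) :
  exists (f : 'I_(\rank A) -> 'I_m) (g : 'I_(\rank A) -> 'I_n),
    \matrix_(a, b) A (f a) (g b) \in unitmx.
Proof.
have full : row_full (rowsub (maxrankfun A) A)^T.
  by rewrite /row_full mxrank_tr; have := maxrowsub_free A.
exists (maxrankfun A), (fullrankfun full).
set M := \matrix_(_, _) _.
suff -> : M = (rowsub (fullrankfun full) (rowsub (maxrankfun A) A)^T)^T.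
  by rewrite unitmx_tr fullrowsub_unit.
by apply/matrixP => a b; rewrite !mxE.
Qed.

(* A maximal invertible minor already selects rows spanning the row space. *)
Lemma maximal_minor_ker (F : fieldType) m n r (A : 'M[F]_(m, n))
    (f : 'I_r -> 'I_m) (g : 'I_r -> 'I_n) (v : 'cV_n) :
    (\rank A <= r)%N -> \matrix_(a, b) A (f a) (g b) \in unitmx ->
  rowsub f A *m v = 0 -> A *m v = 0.
Proof.
move=> Ar Mu fAv; suff /submxP[D ->] : (A <= rowsub f A)%MS by rewrite -mulmxA fAv mulmx0.
suff /eqmxP -> : (rowsub f A == A)%MS by [].
rewrite -(geq_leqif (mxrank_leqif_eq (rowsub_submx A f))).
apply: leq_trans Ar _; rewrite -[X in (X <= _)%N](mxrank_unit Mu) -mxrank_tr.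
rewrite -[X in (_ <= X)%N]mxrank_tr.
suff -> : (\matrix_(a, b) A (f a) (g b))^T = rowsub g (rowsub f A)^T.
  exact/mxrankS/rowsub_submx.
by apply/matrixP => a b; rewrite !mxE.
Qed.

Section LinearForms.
Variables (k : fieldType) (tau : nat).
Implicit Types (e : equation k tau) (c : coef tau).
Notation n := #|coef tau|.
Notation L := (Defs.lin_mx k tau).

Lemma mcoeff1_rho e a : (rho e)@_U_(a) = (pihomog mdeg 1 (rho e))@_U_(a).
Proof.
rewrite {1}rho_split mcoeffD [X in _ + X](dhomog_nemf_coeff (pihomogP _ 2 _)) ?addr0 //.
by rewrite /= mdeg1.
Qed.

(** By quasi-homogeneity the matrix is block diagonal with respect to the weights. *)
Lemma lin_mx_wt i a : L i a != 0 -> coef_deg (enum_val a) = (enum_val i).2.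
Proof.
rewrite mxE mcoeff1_rho -mcoeff_msupp => am.
by have := dhomog_mf (rho1_wdeg _) am; rewrite /= wdegU.
Qed.

Lemma pihomog1_linear e :
  pihomog mdeg 1 (rho e) = \sum_a L (enum_rank e) a *: 'X_a.
Proof.
rewrite [LHS]dhomog1_linear ?pihomogP //; apply: eq_bigr => a _.
by rewrite mxE enum_rankK mcoeff1_rho.
Qed.

Lemma coord_eval_linear e (y : {ffun coef tau -> k}) :
  coord_eval (pihomog mdeg 1 (rho e)) y =
  (L *m (\col_a y (enum_val a))) (enum_rank e) 0.
Proof.
rewrite /coord_eval pihomog1_linear raddf_sum /= !mxE; apply: eq_bigr => a _.
by rewrite mevalZ mevalXU !mxE.
Qed.

Section Solve.
Variables (r : nat) (f : 'I_r -> 'I_#|equation k tau|) (g : 'I_r -> 'I_n).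
Let M := \matrix_(a, b) L (f a) (g b).
Hypothesis Mu : M \in unitmx.

Let ginj : injective g := unitmx_inj Mu.

(* The part of the inverse matrix that respects the weights is still a left
   inverse. *)
Lemma invmx_minor_wt b a : invmx M b a != 0 ->
  coef_deg (enum_val (g b)) = (enum_val (f a)).2.
Proof.
pose N := \matrix_(b, a)
  (if coef_deg (enum_val (g b)) == (enum_val (f a)).2 then invmx M b a else 0).
suff NM : N *m M = 1%:M.
  by rewrite -[invmx M]mul1mx -NM mulmxK // mxE; case: ifP => [/eqP //|_]; rewrite eqxx.
apply/matrixP => b1 b2.
have [wE|wN] := eqVneq (coef_deg (enum_val (g b1))) (coef_deg (enum_val (g b2))).
  rewrite -(mulVmx Mu) mxE [RHS]mxE; apply: eq_bigr => i _.
  rewrite [N _ _]mxE [M _ _]mxE.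
  have [->|/lin_mx_wt] := eqVneq (L (f i) (g b2)) 0; first by rewrite !mulr0.
  by rewrite wE => ->; rewrite eqxx.
rewrite [RHS]mxE; have -> : (b1 == b2) = false by apply: contraNF wN => /eqP ->.
rewrite mxE big1 // => i _; rewrite [N _ _]mxE [M _ _]mxE.
have [->|/lin_mx_wt w2] := eqVneq (L (f i) (g b2)) 0; first by rewrite !mulr0.
by rewrite -w2 (negPf wN) mul0r.
Qed.

Definition eliminated : {set 'I_n} := [set g b | b : 'I_r].

(** One step of a fixed-point iteration: the inverse minor solves the linear part for the pivots,
    with the previous approximation [S] inserted into the quadratic part. *)
Definition sol_step (S : 'I_n -> {mpoly k[n]}) (i : 'I_n) : {mpoly k[n]} :=
  if [pick b | g b == i] is Some b then
    - \sum_a invmx M b a *: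
        (\sum_(j | j \notin eliminated) L (f a) j *: 'X_j
         + (pihomog mdeg 2 (rho (enum_val (f a))) \mPo [tuple S j | j < n]))
  else 'X_i.

Definition sol_iter m : 'I_n -> {mpoly k[n]} :=
  iter m sol_step (fun i => if i \in eliminated then 0 else 'X_i).

Lemma pick_eliminated i :
  if [pick b | g b == i] is Some b then g b = i else i \notin eliminated.
Proof.
case: pickP => [b /eqP //|no]; apply/imsetP => -[b _ iE].
by have := no b; rewrite iE eqxx.
Qed.

Lemma sol_iter_free m i : i \notin eliminated -> sol_iter m i = 'X_i.
Proof.
move=> iN; case: m => [|m] /=; first by rewrite (negPf iN).
rewrite /sol_step; have := pick_eliminated i; case: pickP => // b _ bi.
by case/imsetP: iN; exists b.
Qed.

Lemma sol_iter_pivot m b : sol_iter m.+1 (g b) =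
  - \sum_a invmx M b a *:
      (\sum_(j | j \notin eliminated) L (f a) j *: 'X_j
       + (pihomog mdeg 2 (rho (enum_val (f a))) \mPo [tuple sol_iter m j | j < n])).
Proof.
rewrite /= /sol_step; have := pick_eliminated (g b).
case: pickP => [b' _ /ginj -> //|no]; by have := no b; rewrite eqxx.
Qed.

Lemma sol_iter_wdeg m i :
  sol_iter m i \is (coef_deg (enum_val i)).-homog for (wdeg (@coef_deg tau)).
Proof.
have X_wdeg j : 'X_j \is (coef_deg (enum_val j)).-homog for (wdeg (@coef_deg tau)).
  by rewrite dhomogX /= wdegU.
elim: m i => [|m IH] i; first by rewrite /=; case: ifP => _; [apply: rpred0 | apply: X_wdeg].
rewrite /= /sol_step; case: pickP => [b /eqP <-|_]; last exact: X_wdeg.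
rewrite rpredN; apply: rpred_sum => a _.
have [->|/invmx_minor_wt ->] := eqVneq (invmx M b a) 0; first by rewrite scale0r rpred0.
apply: rpredZ; apply: rpredD.
  apply: rpred_sum => j _; have [->|/lin_mx_wt <-] := eqVneq (L (f a) j) 0.
    by rewrite scale0r rpred0.
  apply: rpredZ; apply: X_wdeg.
apply: comp_mpoly_dhomog; first exact: rho2_wdeg.
by move=> j; rewrite tnth_mktuple.
Qed.

(* Not involving the eliminated variables is homogeneity of degree 0 for the
   degree counting those variables. *)
Lemma sol_iter_vars m i j (mo : 'X_{1..n}) :
  mo \in msupp (sol_iter m i) -> j \in eliminated -> mo j = 0%N.
Proof.
pose wt c : nat := enum_rank c \in eliminated.
have X_wt l : l \notin eliminated -> 'X_l \is 0.-homog for (wdeg wt).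
  by move=> lN; rewrite dhomogX /= wdegU /wt enum_valK (negPf lN).
suff /dhomogP hom : sol_iter m i \is 0.-homog for (wdeg wt).
  move=> /hom; rewrite mfE => /eqP; rewrite sum_nat_eq0 => /forallP/(_ j) /= + jel.
  by rewrite wdegU /wt enum_valK jel muln1 => /eqP.
elim: m i => [|m IH] i.
  by rewrite /=; case: ifP => [_|/negbT]; [rewrite rpred0 | apply: X_wt].
rewrite /= /sol_step; have := pick_eliminated i; case: pickP => [b _ _|_]; last exact: X_wt.
rewrite rpredN; apply: rpred_sum => a _; apply: rpredZ; apply: rpredD.
  by apply: rpred_sum => l lN; apply: rpredZ; apply: X_wt.
apply: (@comp_mpoly_dhomog _ (fun=> 0%N)) => [|l]; last by rewrite tnth_mktuple.
by apply/dhomogP => mo' _; rewrite /= /wdeg big1.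
Qed.

(** A quadratic monomial is a product of two variables of positive weight, so the equations for a
    pivot of weight [w] involve quadratically only variables of weight below [w]. These are already
    stable one step earlier. *)
Lemma sol_iter_stable m i :
  (coef_deg (enum_val i) <= m)%N -> sol_iter m.+1 i = sol_iter m i.
Proof.
elim: m i => [|m IH] i im.
  by have := coef_deg_gt0 (enum_val i); rewrite ltnNge im.
have [/imsetP[b _ iE]|iN] := boolP (i \in eliminated); last by rewrite !sol_iter_free.
rewrite iE (sol_iter_pivot m.+1) (sol_iter_pivot m).
apply: congr1; apply: eq_bigr => a _.
have [->|/invmx_minor_wt wa] := eqVneq (invmx M b a) 0; first by rewrite !scale0r.
congr (_ *: (_ + _)); rewrite !comp_mpolyE big_seq [RHS]big_seq.
apply: eq_bigr => mo mo_in; congr (_ *: _); apply: eq_bigr => j _.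
rewrite !tnth_mktuple; have [->|mo_j] := eqVneq (mo j) 0%N; first by rewrite !expr0.
congr (_ ^+ _); apply: IH.
have := dhomog_mf (rho2_wdeg _) mo_in; have := dhomog_mf (pihomogP _ 2 _) mo_in.
have jmo : (U_(j) <= mo)%MM by rewrite lep1mP.
rewrite -(submK jmo) !mfD /= !wdegU mdeg1 -wa -iE => m1.
have /mdeg1P[l /eqP ->] : mdeg (mo - U_(j)) == 1%N by rewrite -eqSS -addn1 m1.
rewrite wdegU => wE; rewrite -ltnS; apply: leq_trans im; rewrite -wE.
by rewrite -[X in (X < _)%N]add0n ltn_add2r coef_deg_gt0.
Qed.

Definition sol_fix := sol_iter (\max_(c : coef tau) coef_deg c).

Lemma sol_fix_pivot b : sol_fix (g b) =
  - \sum_a invmx M b a *: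
      (\sum_(j | j \notin eliminated) L (f a) j *: 'X_j
       + (pihomog mdeg 2 (rho (enum_val (f a))) \mPo [tuple sol_fix j | j < n])).
Proof.
rewrite -sol_iter_pivot sol_iter_stable //.
exact: (@leq_bigmax (coef tau) (@coef_deg tau)).
Qed.

Lemma sol_fix_eqs a : rho (enum_val (f a)) \mPo [tuple sol_fix j | j < n] = 0.
Proof.
rewrite rho_split raddfD /= pihomog1_linear raddf_sum /= enum_valK.
under eq_bigr do rewrite linearZ /= comp_mpolyXU -tnth_nth tnth_mktuple.
rewrite (bigID [in eliminated]) /= big_imset /=; last by move=> ? ? _ _; apply: ginj.
under [X in _ + X + _]eq_bigr do rewrite /sol_fix sol_iter_free //.
(* [T a] is equation [a] without the linear terms in the pivots. As the minor times its inverse is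
   the identity, those terms contribute exactly [- T a]. *)
set T := fun a => \sum_(j | j \notin eliminated) L (f a) j *: 'X_j
  + (pihomog mdeg 2 (rho (enum_val (f a))) \mPo [tuple sol_fix j | j < n]).
rewrite -addrA -/(T a).
suff -> : \sum_b L (f a) (g b) *: sol_fix (g b) = - T a by rewrite addNr.
under eq_bigr do rewrite sol_fix_pivot scalerN scaler_sumr.
rewrite sumrN exchange_big /=; congr (- _).
transitivity (\sum_a' (M *m invmx M) a a' *: T a').
  apply: eq_bigr => a' _; rewrite mxE scaler_suml; apply: eq_bigr => b _.
  by rewrite scalerA [M _ _]mxE.
rewrite mulmxV // (bigD1 a) //= mxE eqxx scale1r big1 ?addr0 // => a' /negPf a'a.
by rewrite mxE eq_sym a'a scale0r.
Qed.

End Solve.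

Lemma elimination_exists : inhabited (elimination k tau).
Proof.
have [f [g Mu]] := maximal_minor L.
apply: inhabits; apply: (@Elimination _ _ (fun b => enum_val (g b))
  (fun a => enum_val (f a)) (fun c => sol_fix f g (enum_rank c))).
- set N := \matrix_(_, _) _; suff -> : N = \matrix_(a, b) L (f a) (g b) by [].
  by rewrite /N; apply/matrixP => a b; rewrite [LHS]mxE [RHS]mxE; rewrite !enum_valK.
- move=> c cN; apply: sol_iter_free; apply/imsetP => -[b _ cE].
  by case: (cN b); rewrite -cE enum_rankK.
- move=> b m mS b'; rewrite enum_valK; apply: sol_iter_vars mS _.
  exact: imset_f.
- move=> c; rewrite coef_wtE; apply/quasi_homogeneous_wdeg.
  by have := sol_iter_wdeg Mu (\max_(c : coef tau) coef_deg c) (enum_rank c); rewrite enum_rankK.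
- move=> a; rewrite -[RHS](sol_fix_eqs Mu a); congr (_ \mPo _).
  by apply/eq_from_tnth => j; rewrite !tnth_mktuple enum_valK.
Qed.

End LinearForms.

(** * The quadratic cone without eliminations *)

Section HomogeneousEval.
Variables (k : fieldType) (n : nat).
Implicit Types (p : {mpoly k[n]}) (v : 'I_n -> k) (s : 'I_n -> {poly k}).

(** Evaluation along a polynomial curve [s]; the powers of its parameter will separate the
    homogeneous components. *)
Definition peval s p : {poly k} := mmap polyC s p.
HB.instance Definition _ s := GRing.RMorphism.copy (peval s) (peval s).

Lemma pevalX s i : peval s 'X_i = s i.
Proof. by rewrite /peval mmapX mmap1U. Qed.

Lemma pevalZ s c p : peval s (c *: p) = c *: peval s p.
Proof. by rewrite /peval mmapZ mul_polyC. Qed.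

Lemma pevalE s p :
  peval s p = \sum_(m <- msupp p) p@_m *: \prod_i s i ^+ m i.
Proof. by apply: eq_bigr => m _; rewrite mul_polyC. Qed.

Lemma peval_comp s p (t : n.-tuple {mpoly k[n]}) :
  peval s (p \mPo t) = peval (fun i => peval s (tnth t i)) p.
Proof.
rewrite comp_mpolyE raddf_sum pevalE /=; apply: eq_bigr => m _.
rewrite pevalZ rmorph_prod /=; congr (_ *: _).
by apply: eq_bigr => i _; rewrite rmorphXn.
Qed.

(* Restricting p to the line through v separates its homogeneous components. *)
Lemma peval_line_coef v p d :
  (peval (fun i => v i *: 'X) p)`_d = (pihomog mdeg d p).@[v].
Proof.
rewrite pevalE coef_sum pihomogE raddf_sum /= [RHS]big_mkcond /=.
apply: eq_bigr => m _; rewrite coefZ.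
have -> : \prod_i (v i *: 'X) ^+ m i = (\prod_i v i ^+ m i) *: 'X^(mdeg m) :> {poly k}.
  under eq_bigr do rewrite exprZn.
  rewrite scaler_prod mdegE; congr (_ *: _).
  by rewrite (big_morph (fun e => 'X^e) (@exprD _ 'X) (expr0 _)).
rewrite coefZ coefXn eq_sym; case: eqP => _; rewrite ?mulr0 // mulr1.
by rewrite mevalZ mevalX.
Qed.

Lemma peval_scale s p d : p \is d.-homog ->
  peval (fun i => 'X * s i) p = 'X^d * peval s p.
Proof.
move=> /dhomogP hp; rewrite !pevalE big_seq [in RHS]big_seq mulr_sumr.
apply: eq_bigr => m /hp <-; rewrite -scalerAr; congr (_ *: _).
under eq_bigr do rewrite exprMn.
rewrite big_split /= mdegE; congr (_ * _).
by rewrite (big_morph (fun e => 'X^e) (@exprD _ 'X) (expr0 _)).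
Qed.

Lemma peval_coef0 s p : (peval s p)`_0 = p.@[fun i => (s i)`_0].
Proof.
rewrite pevalE coef_sum mevalE; apply: eq_bigr => m _; rewrite coefZ; congr (_ * _).
rewrite -horner_coef0 horner_prod; apply: eq_bigr => i _.
by rewrite horner_exp horner_coef0.
Qed.
End HomogeneousEval.

Section QuadraticCone.
Variables (k : fieldType) (tau : nat) (E : elimination k tau).
Implicit Types (e : equation k tau) (c : coef tau) (x y : {ffun coef tau -> k}).
Notation n := #|coef tau|.
Notation L := (Defs.lin_mx k tau).

Let f a := enum_rank (eqs E a).
Let g b := enum_rank (piv E b).

Lemma elim_minor : \matrix_(a, b) L (f a) (g b) \in unitmx.
Proof. exact: elim_unit E. Qed.

Definition colv (y : {ffun coef tau -> k}) : 'cV[k]_n := \col_a y (enum_val a).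

Lemma rowsub_mulE (v : 'cV_n) a : (rowsub f L *m v) a 0 = (L *m v) (f a) 0.
Proof. by rewrite mul_rowsub_mx mxE. Qed.

Lemma elim_eqs_lin (v : 'cV_n) :
  (forall a, (L *m v) (f a) 0 = 0) -> L *m v = 0.
Proof.
move=> h; apply: (maximal_minor_ker _ elim_minor) => //.
by apply/colP => a; rewrite rowsub_mulE h mxE.
Qed.

(** When the free coordinates vanish, the eliminated equations form a square invertible system in
    the pivots. *)
Lemma elim_free_lin (v : 'cV_n) :
  L *m v = 0 -> (forall c, (forall b, piv E b <> c) -> v (enum_rank c) 0 = 0) -> v = 0.
Proof.
move=> Lv v0; pose w : 'cV_(\rank L) := \col_b v (g b) 0.
have freeN i : i \notin [set g b | b in predT] -> v i 0 = 0.
  move=> iN; rewrite -(enum_valK i); apply: v0 => b bi; case/imsetP: iN.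
  by exists b => //; rewrite /g bi enum_valK.
suff w0 : w = 0.
  apply/colP => i; rewrite [RHS]mxE; have [/imsetP[b _ ->]|/freeN //] := boolP (i \in [set g b | b in predT]).
  by have /colP/(_ b) := w0; rewrite !mxE.
apply: (can_inj (mulKmx elim_minor)); rewrite mulmx0; apply/colP => a.
have Lva : (L *m v) (f a) 0 = 0 by rewrite Lv mxE.
rewrite [RHS]mxE -Lva [LHS]mxE [RHS]mxE [RHS](bigID [in [set g b | b in predT]]) /= [X in _ + X]big1 ?addr0; last first.
  by move=> i /freeN ->; rewrite mulr0.
rewrite big_imset /=; last by move=> ? ? _ _; apply: (unitmx_inj elim_minor).
by apply: eq_bigr => b _; rewrite [_ a b]mxE [w _ _]mxE.
Qed.

Lemma T_H_lin x : T_H x <-> L *m colv x = 0.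
Proof.
split=> [Tx|Lx e]; last by rewrite coord_eval_linear Lx mxE.
apply/colP => i; rewrite [RHS]mxE -[RHS](Tx (enum_val i)).
by rewrite coord_eval_linear enum_valK.
Qed.

(** Along the line through [x], the expressions [sol] become [s = x1 X + y1 X^2 + ...]. For [x] in
    [T_H] one has [x1 = x], and then the degree 2 part of [h_poly] at [x] is the linear part at [y1]
    plus the quadratic part at [x]. It vanishes for the eliminated equations, so [x] lies in [Q_H]
    exactly when [y1] is a solution. *)
Lemma Q_H_char x : Q_H E x <->
  T_H x /\ exists y, forall e,
    coord_eval (pihomog mdeg 1 (rho e)) y + coord_eval (pihomog mdeg 2 (rho e)) x = 0.
Proof.
pose line (i : 'I_n) := x (enum_val i) *: ('X : {poly k}).
pose s (i : 'I_n) := peval line (sol E (enum_val i)).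
(* A constant monomial has weight 0, while every coefficient has positive weight. *)
have s0 i : (s i)`_0 = 0.
  rewrite /s peval_line_coef pihomogE big1_seq ?meval0 // => m /andP[/eqP m0 min].
  have := sol_homog min.
  rewrite coef_wtE big1 => [/eqP|j _].
    by have := coef_deg_gt0 (enum_val i); case: (coef_deg _).
  by have /eqP := m0; rewrite mdeg_eq0 => /eqP ->; rewrite mnm0E.
pose t i := \poly_(j < size (s i)) (s i)`_j.+1.
have st i : s i = 'X * t i.
  apply/polyP => -[|j]; rewrite mulrC coefMX /= ?s0 // coef_poly.
  by case: ltnP => // /leqW /leq_sizeP ->.
pose x1 : {ffun coef tau -> k} := [ffun c => (t (enum_rank c))`_0].
pose y1 : {ffun coef tau -> k} := [ffun c => (t (enum_rank c))`_1].
have coefh d e : (pihomog mdeg d (h_poly E e)).@[fun a => x (enum_val a)] =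
    (\sum_a L (enum_rank e) a *: s a + 'X^2 * peval t (pihomog mdeg 2 (rho e)))`_d.
  rewrite -peval_line_coef -/line /h_poly peval_comp; congr (_`_d).
  have -> : peval (fun i => peval line (tnth [tuple sol E (enum_val i) | i < n] i)) (rho e)
          = peval (fun i => 'X * t i) (rho e).
    rewrite !pevalE; apply: eq_bigr => m _; congr (_ *: _).
    by apply: eq_bigr => i _; rewrite tnth_mktuple -st.
  rewrite {1}rho_split raddfD /= (peval_scale t (pihomogP mdeg 2 (rho e))).
  rewrite pihomog1_linear raddf_sum /=.
  by under eq_bigr do rewrite pevalZ pevalX -st.
have lin_coef e d (y : {ffun coef tau -> k}) : (forall a, y (enum_val a) = (t a)`_d) ->
    (\sum_a L (enum_rank e) a *: s a)`_d.+1 = coord_eval (pihomog mdeg 1 (rho e)) y.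
  move=> yE; rewrite coord_eval_linear mxE coef_sum; apply: eq_bigr => a _.
  by rewrite coefZ st coefXM -yE; congr (_ * _); rewrite mxE.
have h1 e : (pihomog mdeg 1 (h_poly E e)).@[fun a => x (enum_val a)] =
    coord_eval (pihomog mdeg 1 (rho e)) x1.
  rewrite coefh coefD coefXnM /= addr0; apply: lin_coef => a.
  by rewrite ffunE enum_valK.
(* The vector [x1] always solves the linear equations and agrees with [x] at the free coefficients.
   If it differs from [x], then [x] is not in [T_H] and both sides fail. *)
have [x1x|] := eqVneq x1 x; last first.
  move=> x1x; suff NT : ~ T_H x by split=> [[/NT]|[/NT]].
  move=> /T_H_lin Lx; case/eqP: x1x; have Lx1 : L *m colv x1 = 0.
    apply: elim_eqs_lin => a; rewrite -coord_eval_linear -h1.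
    by rewrite /h_poly (sol_eqs E a) pihomog0 meval0.
  suff /colP d0 : colv x1 - colv x = 0.
    apply/ffunP => c; have /eqP := d0 (enum_rank c).
    by rewrite !mxE enum_rankK subr_eq0 => /eqP.
  apply: elim_free_lin; first by rewrite mulmxBr Lx1 Lx subrr.
  move=> c cN; rewrite !mxE enum_rankK ffunE -[(t _)`_0]/((t (enum_rank c))`_(1.-1)).
  have -> : (t (enum_rank c))`_0 = (s (enum_rank c))`_1 by rewrite st coefXM.
  by rewrite /s enum_rankK (sol_free cN) pevalX /line enum_rankK coefZ coefX mulr1 subrr.
have h2 e : coord_eval (pihomog mdeg 2 (h_poly E e)) x =
    coord_eval (pihomog mdeg 1 (rho e)) y1 + coord_eval (pihomog mdeg 2 (rho e)) x.
  rewrite {1}/coord_eval coefh coefD; congr (_ + _).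
    by apply: lin_coef => a; rewrite ffunE enum_valK.
  rewrite coefXnM /= peval_coef0; apply: meval_eq => a.
  by rewrite -[in RHS]x1x ffunE enum_valK.
have eq0 a : coord_eval (pihomog mdeg 2 (h_poly E (eqs E a))) x = 0.
  by rewrite /h_poly (sol_eqs E a) pihomog0 /coord_eval meval0.
split=> [[Tx Qx]|[Tx [y hy]]]; split=> //.
  exists y1 => e; rewrite -h2.
  have [/existsP[a /eqP <-]|/existsPn eN] := boolP [exists a, eqs E a == e].
    exact: eq0.
  by apply: Qx => a ae; have := eN a; rewrite ae eqxx.
(* A given solution [y] and [y1] have the same image in the eliminated equations, hence in all of
   them, because those rows span the row space. *)
move=> e _; rewrite h2 -[RHS](hy e); congr (_ + _); rewrite !coord_eval_linear.
suff /eqP : L *m (colv y1 - colv y) = 0.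
  by rewrite mulmxBr subr_eq0 => /eqP; rewrite /colv => ->.
apply: elim_eqs_lin => a; rewrite mulmxBr mxE [X in _ + X]mxE -!coord_eval_linear.
apply/eqP; rewrite subr_eq0; apply/eqP.
apply: (@addIr _ (coord_eval (pihomog mdeg 2 (rho (eqs E a))) x)).
by rewrite -h2 eq0 hy.
Qed.
End QuadraticCone.

(** * Columns *)

Lemma mem_coefs tau s i j m : (0 < j <= 6)%N ->
  ((s, i, j + 6 * m)%N \in coefs tau) =
  [&& (s, i, j) \in partials, (j + 6 * m <= formal_degree tau (s, i, j))%N
    & (s, i, j + 6 * m)%N \notin [:: (ltr_g, 4, 1); (ltr_g, 4, 2); (ltr_g, 4, 6)]%N].
Proof.
move=> j16; rewrite /coefs mem_filter andbC andbA; congr (_ && _).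
have partials_res u : u \in partials -> (0 < u.2 <= 6)%N.
  by move: u; apply/allP.
apply/allpairsPdep/andP => [[[[s' i'] j'] [r [up]]]|[jp jfd]].
  rewrite mem_filter mem_iota [(_, _).2]/= => /andP[/eqP rj' /andP[r0 rfd]] [-> -> rE].
  have := partials_res _ up => /= j'16.
  have jj : j = j' by lia.
  by subst j'; split=> //; rewrite rE -ltnS -add1n.
exists (s, i, j), (j + 6 * m)%N; split=> //.
rewrite mem_filter mem_iota [(_, _).2]/= add1n ltnS jfd andbT.
by apply/andP; split; lia.
Qed.

Lemma formal_degree_le tau s i j : (s, i, j) \in partials ->
  (formal_degree tau (s, i, j) <= 12 * tau + 10)%N.
Proof.
move=> sij; have : all (fun u => (u.1.2 <= 10) && (u.2 <= 6))%N partials by [].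
move=> /allP/(_ _ sij) /= /andP[i10 j6]; rewrite /formal_degree.
case: ifP => _; first by lia.
case: ifP => _; first by lia.
case: ifP => [|_]; last by lia.
by rewrite !inE => /or3P[] /eqP[_ _ ->]; lia.
Qed.

Section Columns.
Variables (k : fieldType) (tau : nat).
Implicit Types (x y : {ffun coef tau -> k}).

Definition value x (v : bool * nat * nat) : k :=
  if insub v is Some c then x (c : coef tau) else 0.

Lemma value_out x v : v \notin coefs tau -> value x v = 0.
Proof. by move=> vN; rewrite /value insubN. Qed.

(** Nothing is truncated: formal degrees are at most [12 * tau + 10] and [j] is at least 1, so [m]
    is at most [2 * tau + 1]. *)
Definition column x s i j : {poly k} :=
  \poly_(m < (2 * tau).+2) value x (s, i, j + 6 * m)%N.

Lemma coef_column x s i j m : (0 < j <= 6)%N ->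
  (column x s i j)`_m = value x (s, i, j + 6 * m)%N.
Proof.
move=> j16; rewrite coef_poly; case: ltnP => // mbig.
rewrite value_out // mem_coefs //; apply/and3P => -[sij jm _].
by have := leq_trans jm (formal_degree_le tau sij); lia.
Qed.

(** Unrolled so that [ring] can handle identities between assembled polynomials. The residues are 1
    to 6, hence there is no constant term. *)
Definition assemble (c : nat -> {poly k}) : {poly k} :=
  'X * (c 1%N \Po 'X^6) + 'X^2 * (c 2%N \Po 'X^6) + 'X^3 * (c 3%N \Po 'X^6)
  + 'X^4 * (c 4%N \Po 'X^6) + 'X^5 * (c 5%N \Po 'X^6) + 'X^6 * (c 6%N \Po 'X^6).

Lemma assembleE c : assemble c = \sum_(j <- iota 1 6) 'X^j * (c j \Po 'X^6).
Proof. by rewrite unlock /= addr0 /assemble !addrA expr1. Qed.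

Lemma coef_shifted_comp (p : {poly k}) a j m : (0 < a <= 6)%N -> (0 < j <= 6)%N ->
  ('X^a * (p \Po 'X^6))`_(j + 6 * m) = if a == j then p`_m else 0.
Proof.
move=> a16 j16; rewrite coefXnM coef_comp_poly_Xn //.
case: eqP => [->|aj]; last by case: ltnP => // ?; case: ifP => // /dvdnP[q]; lia.
by rewrite ltnNge leq_addr addKn dvdn_mulr // mulKn.
Qed.

Lemma coef_assemble c j m : (0 < j <= 6)%N -> (assemble c)`_(j + 6 * m) = (c j)`_m.
Proof.
move=> j16; rewrite /assemble -[X in X * (c 1%N \Po _)]expr1 !coefD !coef_shifted_comp //.
by case: j j16 => [|[|[|[|[|[|[|j]]]]]]] //= _; rewrite ?add0r ?addr0.
Qed.

Lemma residue_decomposition r : (0 < r)%N ->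
  exists j m, (0 < j <= 6)%N /\ r = (j + 6 * m)%N.
Proof. by move=> r0; exists ((r.-1 %% 6).+1)%N, (r.-1 %/ 6)%N; split; lia. Qed.

Lemma assemble_inj c c' :
  assemble c = assemble c' <-> forall j, (0 < j <= 6)%N -> c j = c' j.
Proof.
split=> [cc' j j16|cc']; last by rewrite /assemble !cc'.
by apply/polyP => m; rewrite -!coef_assemble // cc'.
Qed.

Notation ev x := (map_poly (meval (fun a => x (enum_val a)))).

Lemma ev_partial x s i j : (0 < j <= 6)%N ->
  ev x (partial_poly k tau s i j) = 'X^j * (column x s i j \Po 'X^6).
Proof.
move=> j16; apply/polyP => r; rewrite coef_map /= /partial_poly coef_sum raddf_sum /=.
have val_ev v : (coef_var k tau v).@[fun a => x (enum_val a)] = value x v.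
  rewrite /coef_var /value; case: insubP => [c _ _|_]; last exact: meval0.
  by rewrite mevalXU enum_rankK.
under eq_bigr => l _ do rewrite mul_polyC coefZ coefXn.
have [r0|/residue_decomposition[j' [m [j'16 rE]]]] := posnP r.
  (* The exponent 0 is congruent to 6, but no coefficient has weight 0. *)
  rewrite r0 coefXnM; case: (j) j16 => // j0 _ /=; rewrite big1 // => l _.
  case: eqP => [l0|_]; last by rewrite mulr0 meval0.
  rewrite mulr1 val_ev -l0 value_out //; apply/negP; rewrite /coefs mem_filter.
  by case/andP => _ /allpairsPdep[u [r1 []]]; rewrite mem_filter mem_iota => _ /and3P[_ r1_gt0 _] [_ r1E]; lia.
have -> : ('X^j * (column x s i j \Po 'X^6))`_r =
    if j == j' then value x (s, i, r) else 0.
  by rewrite rE coef_shifted_comp //; case: eqP => // ->; rewrite coef_column.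
case: (ltnP r (12 * tau + 11)) => rbig; last first.
  rewrite big1 => [|l _]; last by rewrite gtn_eqF ?mulr0 ?meval0 // (leq_trans (ltn_ord l)).
  case: eqP => // jj'; rewrite value_out // rE mem_coefs //; apply/and3P => -[sij jm _].
  by have := leq_trans jm (formal_degree_le tau sij); lia.
case: (eqVneq j j') => [jj'|jj'].
  rewrite (bigD1 (Ordinal rbig)) /=; last by rewrite rE jj'; lia.
  rewrite eqxx mulr1 val_ev big1 ?addr0 // => l /andP[_ /eqP ll].
  case: eqP => [lE|_]; last by rewrite mulr0 meval0.
  by case: ll; apply: val_inj => /=; lia.
rewrite big1 // => l lj; case: eqP => [lE|_]; last by rewrite mulr0 meval0.
by case/eqP: jj'; lia.
Qed.

Lemma column_out x s i j : (s, i, j) \notin partials -> (0 < j <= 6)%N ->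
  column x s i j = 0.
Proof.
move=> sij j16; apply/polyP => m; rewrite coef_column // coef0 value_out //.
by rewrite mem_coefs // (negPf sij).
Qed.

Lemma ev_full x s i : (s, i) \in [seq u.1 | u <- partials] ->
  ev x (full_poly k tau s i) = assemble (column x s i).
Proof.
move=> si; rewrite /full_poly raddf_sum /= big_seq_cond.
under eq_bigr => u /andP[up /eqP uE].
  rewrite ev_partial; first over.
  by move: u up {uE}; apply/allP.
rewrite -big_seq_cond -big_filter.
have -> : [seq u <- partials | u.1 == (s, i)] =
    [seq (s, i, j) | j <- iota 1 6 & (s, i, j) \in partials].
  move: si; rewrite -mem_undup.
  have -> : undup [seq u.1 | u <- partials] =
    [:: (ltr_g, 4); (ltr_g, 5); (ltr_g, 6); (ltr_g, 7); (ltr_g, 8);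
        (ltr_f, 6); (ltr_f, 8); (ltr_f, 9); (ltr_f, 10)]%N by [].
  by rewrite !inE => /or4P[|||/or4P[|||/or3P[]]] /eqP[-> ->].
rewrite big_map big_filter big_mkcond assembleE; apply: eq_big_seq => j.
rewrite mem_iota => j17 /=; case: ifP => // /negbT sij.
by rewrite column_out // comp_poly0 mulr0.
Qed.
End Columns.

(** * The equations in columns *)

Section RelationShape.
Variables P Q : nzRingType.
Variables (h : {rmorphism P -> Q}) (g f : nat -> P) (gp fp : nat -> nat -> P).
Variables (g' f' : nat -> Q) (gp' fp' : nat -> nat -> Q).

Lemma linear_part_map (i : 'I_5) :
    (forall a, a \in [:: 4; 5; 6; 7; 8]%N -> h (g a) = g' a) ->
    (forall a, a \in [:: 6; 8; 9; 10]%N -> h (f a) = f' a) ->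
  h (tnth (linear_part g f) i) = tnth (linear_part g' f') i.
Proof.
move=> hg hf; rewrite !(tnth_nth 0).
by case: i => [[|[|[|[|[|i]]]]] hi] //=; rewrite ?(rmorphD, rmorphN) /= ?hg ?hf.
Qed.

Lemma quadratic_part_map (i : 'I_5) :
    (forall a, a \in [:: 4; 5; 6; 7; 8]%N -> h (g a) = g' a) ->
    (forall a, a \in [:: 6; 8; 9; 10]%N -> h (f a) = f' a) ->
    (forall a j, (0 < j <= 6)%N -> h (gp a j) = gp' a j) ->
    (forall a j, (0 < j <= 6)%N -> h (fp a j) = fp' a j) ->
  h (tnth (quadratic_part g f gp fp) i) = tnth (quadratic_part g' f' gp' fp') i.
Proof.
move=> hg hf hgp hfp; rewrite !(tnth_nth 0).
by case: i => [[|[|[|[|[|i]]]]] hi] //=;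
  rewrite ?(rmorphD, rmorphN, rmorphM) /= ?hg ?hf ?hgp ?hfp.
Qed.
End RelationShape.

Section Equations.
Variables (k : fieldType) (tau : nat).
Implicit Types (x y : {ffun coef tau -> k}) (i : 'I_5).

Notation ev x := (map_poly (meval (fun a => x (enum_val a)))).

Definition shifted (c : bool -> nat -> nat -> {poly k}) s a j : {poly k} :=
  'X^j * (c s a j \Po 'X^6).
Definition joined (c : bool -> nat -> nat -> {poly k}) s a := assemble (c s a).

Lemma ev_lin_rel x i : ev x (tnth (lin_rel k tau) i) =
  tnth (linear_part (joined (column x) ltr_g) (joined (column x) ltr_f)) i.
Proof.
apply: linear_part_map => a a_in; apply: ev_full.
  by move: a a_in; apply/allP.
by move: a a_in; apply/allP.
Qed.

Lemma ev_quad_rel x i : ev x (tnth (quad_rel k tau) i) =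
  tnth (quadratic_part (joined (column x) ltr_g) (joined (column x) ltr_f)
          (shifted (column x) ltr_g) (shifted (column x) ltr_f)) i.
Proof.
apply: quadratic_part_map => [a a_in|a a_in|a j|a j].
- by apply: ev_full; move: a a_in; apply/allP.
- by apply: ev_full; move: a a_in; apply/allP.
- exact: ev_partial.
- exact: ev_partial.
Qed.

Lemma linear_part_joined (c : bool -> nat -> nat -> {poly k}) i :
  tnth (linear_part (joined c ltr_g) (joined c ltr_f)) i =
  assemble (fun j => tnth (linear_part (c ltr_g ^~ j) (c ltr_f ^~ j)) i).
Proof.
elim/I5P: i; rewrite /assemble !(tnth_nth 0) !inordK //= /joined /assemble.
all: by rewrite ?(comp_polyD, comp_polyB); ring.
Qed.

(** The type [equation] stops at the size of the relations. Beyond it the difference of the two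
    parts is zero, and so is each part, since they have different degrees in the unknowns. *)
Lemma lin_quad_rel_high i r :
  (\max_(i < 5) size (tnth (relations k tau) i) <= r)%N ->
  (tnth (lin_rel k tau) i)`_r = 0 /\ (tnth (quad_rel k tau) i)`_r = 0.
Proof.
move=> r_big; have rel0 : (tnth (relations k tau) i)`_r = 0.
  by rewrite nth_default //; apply: leq_trans r_big; apply: leq_bigmax.
have [l1 _] := lin_rel_bigraded k tau i r; have [q2 _] := quad_rel_bigraded k tau i r.
move: rel0; rewrite relationsE coefB => /esym rel0.
have [] := pihomog_lin_quad rel0 l1 q2; rewrite !pihomog0 => <- /eqP.
by rewrite eq_sym oppr_eq0 => /eqP.
Qed.

Lemma T_H_column x : T_H x <-> forall i j, (0 < j <= 6)%N ->
  tnth (linear_part (column x ltr_g ^~ j) (column x ltr_f ^~ j)) i = 0.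
Proof.
have asm0 : assemble (fun=> 0) = 0 :> {poly k} by rewrite /assemble comp_poly0 !mulr0 !addr0.
split=> [Tx i|Tx e].
  apply/assemble_inj; rewrite -linear_part_joined -ev_lin_rel asm0.
  apply/polyP => r; rewrite coef0 coef_map /=.
  have [r_big|r_small] := leqP (\max_(i < 5) size (tnth (relations k tau) i)) r.
    by have [-> _] := lin_quad_rel_high i r_big; rewrite meval0.
  by have := Tx (i, Ordinal r_small); rewrite pihomog1_rho.
rewrite pihomog1_rho /coord_eval -coef_map ev_lin_rel linear_part_joined.
by move/assemble_inj: (Tx e.1) => ->; rewrite asm0 coef0.
Qed.

Lemma equations_column x y :
  (forall e : equation k tau, coord_eval (pihomog mdeg 1 (rho e)) y
                      + coord_eval (pihomog mdeg 2 (rho e)) x = 0) <->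
  forall i, assemble (fun j => tnth (linear_part (column y ltr_g ^~ j) (column y ltr_f ^~ j)) i) =
    tnth (quadratic_part (joined (column x) ltr_g) (joined (column x) ltr_f)
          (shifted (column x) ltr_g) (shifted (column x) ltr_f)) i.
Proof.
split=> [h i|h e].
  rewrite -linear_part_joined -ev_lin_rel -ev_quad_rel.
  apply/polyP => r; rewrite !coef_map /=.
  have [r_big|r_small] := leqP (\max_(i < 5) size (tnth (relations k tau) i)) r.
    by have [-> ->] := lin_quad_rel_high i r_big; rewrite !meval0.
  have := h (i, Ordinal r_small); rewrite pihomog1_rho pihomog2_rho /coord_eval mevalN.
  by move=> /eqP; rewrite subr_eq0 => /eqP.
rewrite pihomog1_rho pihomog2_rho /coord_eval mevalN; apply/eqP; rewrite subr_eq0.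
by rewrite -!coef_map ev_lin_rel ev_quad_rel linear_part_joined h.
Qed.
End Equations.

(** * Parametrization of the linear solutions by eleven letters *)

Section Letters.
Variable k : fieldType.

(* The letters are the columns f6_1, f9_1, g8_2, f10_2, f6_3, f8_4, f10_4, f10_5,
   g5_6, f8_6, f9_6 of a point of T_H. *)
Record params := Params {
  pa : {poly k}; pb : {poly k}; pp : {poly k}; pq : {poly k}; pc : {poly k};
  pd : {poly k}; pe : {poly k}; pu : {poly k}; pw : {poly k}; py : {poly k};
  pz : {poly k} }.

(** The general solution of the linear equations, column by column; columns that are not listed are
    either absent or forced to vanish. *)
Definition tcol (l : params) (s : bool) (i j : nat) : {poly k} :=
  let: Params a b p q c d e u w y z := l in
  match s, i, j with
  | false, 4%N, 1%N => a | false, 4%N, 2%N => - p | false, 4%N, 4%N => e - d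
  | false, 4%N, 5%N => u | false, 4%N, 6%N => w
  | false, 5%N, 1%N => a - b | false, 5%N, 6%N => w
  | false, 6%N, 1%N => a - b | false, 6%N, 2%N => p + q | false, 6%N, 4%N => d
  | false, 6%N, 6%N => w + y
  | false, 7%N, 1%N => - b | false, 7%N, 2%N => p | false, 7%N, 4%N => d - e
  | false, 7%N, 5%N => - u
  | false, 8%N, 2%N => p | false, 8%N, 3%N => c | false, 8%N, 4%N => d - e
  | false, 8%N, 5%N => - u | false, 8%N, 6%N => z
  | true, 6%N, 1%N => a | true, 6%N, 3%N => c | true, 6%N, 6%N => w + z
  | true, 8%N, 2%N => p + q | true, 8%N, 4%N => d | true, 8%N, 6%N => y
  | true, 9%N, 1%N => b | true, 9%N, 3%N => c | true, 9%N, 6%N => z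
  | true, 10%N, 1%N => b | true, 10%N, 2%N => q | true, 10%N, 4%N => e
  | true, 10%N, 5%N => u | true, 10%N, 6%N => y
  | _, _, _ => 0
  end.

(* The polynomials om 0, ..., om 9 stand for omega_1, ..., omega_10; the shift by
   'X makes residue 5 into residue -1, the weight of omega_8. *)
Definition om (l : params) : seq {poly k} :=
  let: Params a b p q c d e u w y z := l in
  [:: a; b; p; q; c; d; e - d; 'X * u; y - z; w - z].

Definition W_lhs (R : nzRingType) (o : nat -> R) (n : nat) : R :=
  match n with
  | 0%N => o 1%N * o 9%N + o 5%N * o 6%N - o 2%N * o 10%N
  | 1%N => o 4%N * o 10%N + o 3%N * o 9%N - o 6%N * o 7%N
  | 2%N => o 1%N * o 4%N + o 2%N * o 3%N + o 6%N * o 8%N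
  | 3%N => o 8%N * o 10%N + o 3%N * o 5%N + o 1%N * o 7%N
  | _ => o 2%N * o 7%N + o 8%N * o 9%N - o 4%N * o 5%N
  end.

(* The classes of the quadratic parts modulo the image of the linear parts. *)
Definition obstruction (l : params) (n : nat) : {poly k} :=
  W_lhs (fun a => (om l)`_a.-1) n.

(* The column of residue j of the i-th quadratic part at the point tcol l of T_H;
   the factors 'X come from products whose residues add up to more than 6. *)
Definition qcol (l : params) (i j : nat) : {poly k} :=
  let: Params a b p q c d e u w y z := l in
  match i, j with
  | 0%N, 2%N => a * b - 'X * c * u + 'X * z * p
  | 0%N, 4%N => c * (a - b) + 'X * (e - d) * w
  | 0%N, 5%N => c * p + (e - d) * a + 'X * u * (w - z)
  | 0%N, 6%N => u * (a - b) - 'X * z * w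
  | 1%N, 1%N => 'X * obstruction l 0
  | 1%N, 3%N => a * q + b * p + 'X * c * y
  | 1%N, 5%N => a * e + c * (p + q) - b * (e - d)
  | 1%N, 6%N => u * (a - b) - 'X * z * w
  | 2%N, 1%N => 'X * obstruction l 0
  | 2%N, 2%N => 'X * (d * (d - e) - z * (p + q)) - b * (a - b)
  | 2%N, 3%N => 'X * (y * c - d * u)
  | 2%N, 6%N => d * p + 'X * (w * (y - z))
  | 3%N, 1%N => 'X * (c * d - u * (p + q) - b * w)
  | 3%N, 2%N => - ('X * y * p) - b * (a - b) - 'X * q * w
  | 3%N, 3%N => - obstruction l 2
  | 3%N, 4%N => 'X * (d * z - y * (d - e))
  | 4%N, 2%N => 'X * (z * (p + q) - u * c - y * p - q * (w + z)) + b * b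
  | 4%N, 3%N => - ('X * y * c) - b * p - q * a
  | 4%N, 4%N => 'X * (d * z - y * (d - e))
  | 4%N, 5%N => 'X * u * (y - z) + b * (e - d) - q * c
  | _, _ => 0
  end.

Lemma linear_part_tcol l (i : 'I_5) j : (0 < j <= 6)%N ->
  tnth (linear_part (tcol l ltr_g ^~ j) (tcol l ltr_f ^~ j)) i = 0.
Proof.
case: l => a b p q c d e u w y z; case: j => [|[|[|[|[|[|[|j]]]]]]] // _.
all: elim/I5P: i; rewrite !(tnth_nth 0) !inordK //=; ring.
Qed.

Lemma quadratic_part_tcol l (i : 'I_5) :
  tnth (quadratic_part (joined (tcol l) ltr_g) (joined (tcol l) ltr_f)
          (shifted (tcol l) ltr_g) (shifted (tcol l) ltr_f)) i =
  assemble (qcol l i).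
Proof.
(* Substitution of ['X^6] becomes an abstract additive and multiplicative map, so that [ring] sees
   only its values at the letters. *)
pose S (f : {poly k}) : {poly k} := f \Po 'X^6.
have SE (f : {poly k}) : f \Po 'X^6 = S f by [].
have SN f : S (- f) = - S f by exact: raddfN.
have SD f g : S (f + g) = S f + S g by exact: comp_polyD.
have SM f g : S (f * g) = S f * S g by exact: comp_polyM.
have S0 : S 0 = 0 by exact: comp_poly0.
have SX : S 'X = 'X^6 by exact: comp_polyX.
case: l => a b p q c d e u w y z; rewrite !(tnth_nth 0).
case: i => [[|[|[|[|[|i]]]]] hi] //=; rewrite /joined /shifted /assemble /=.
all: rewrite !SE; move: S SE SN SD SM S0 SX => S _ SN SD SM S0 SX.
all: rewrite ?(SD, SN, SM, SX, S0).
all: ring.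
Qed.
End Letters.

(** * Solving the linear equations *)

Section SizeBounds.
Variable k : fieldType.
Implicit Types p q : {poly k}.

Lemma size_add_bound p q a b : (size p <= a.+1)%N -> (size q <= b.+1)%N ->
  (size (p + q)%R <= (maxn a b).+1)%N.
Proof. by move=> pa qb; apply: leq_trans (size_polyD _ _) _; lia. Qed.

Lemma size_opp_bound p a : (size p <= a.+1)%N -> (size (- p)%R <= a.+1)%N.
Proof. by rewrite size_polyN. Qed.

Lemma size_mul_bound p q a b : (size p <= a.+1)%N -> (size q <= b.+1)%N ->
  (size (p * q)%R <= (a + b).+1)%N.
Proof. by move=> pa qb; apply: leq_trans (size_polyMleq _ _) _; lia. Qed.

Lemma size_X_bound : (size ('X : {poly k}) <= 2)%N.
Proof. by rewrite size_polyX. Qed.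

Lemma size_weaken p a b : (size p <= a.+1)%N -> (a <= b)%N -> (size p <= b.+1)%N.
Proof. by move=> /leq_trans pa ab; apply: pa. Qed.

Lemma coef_neq0_size p m b : (size p <= b.+1)%N -> p`_m != 0 -> (m <= b)%N.
Proof. by move=> pb; apply: contraNT; rewrite -ltnNge => bm; rewrite nth_default // (leq_trans pb). Qed.
End SizeBounds.

(** Computes a degree bound along the expression, the bounds of the letters being taken from the
    context; [lia] then compares it with the goal. *)
Ltac size_bound_rec :=
  lazymatch goal with
  | |- is_true (leq (size (polyseq (_ + _))) _) =>
      eapply size_add_bound; [size_bound_rec | size_bound_rec]
  | |- is_true (leq (size (polyseq (- _))) _) =>
      eapply size_opp_bound; size_bound_rec
  | |- is_true (leq (size (polyseq (_ * _))) _) =>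
      eapply size_mul_bound; [size_bound_rec | size_bound_rec]
  | |- is_true (leq (size (polyseq 'X)) _) => exact: size_X_bound
  | |- _ => eassumption
  end.

Ltac size_bound := eapply size_weaken; [size_bound_rec | lia].

Section Solutions.
Variables (k : fieldType) (tau : nat).
Hypothesis tau0 : (0 < tau)%N.
Implicit Types (x y : {ffun coef tau -> k}) (l : params k).

Definition point (c : bool -> nat -> nat -> {poly k}) : {ffun coef tau -> k} :=
  [ffun v => let: (s, i, r) := ssval v in (c s i (r.-1 %% 6).+1)`_(r.-1 %/ 6)].

Definition supported (c : bool -> nat -> nat -> {poly k}) : Prop :=
  forall s i j m, (0 < j <= 6)%N -> (c s i j)`_m != 0 ->
  (s, i, j + 6 * m)%N \in coefs tau.

Lemma column_point c : supported c ->
  forall s i j, (0 < j <= 6)%N -> column (point c) s i j = c s i j.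
Proof.
move=> supp s i j j16; apply/polyP => m; rewrite coef_column // /value.
case: insubP => [v _ vE|vN].
  rewrite ffunE vE.
  have -> : ((j + 6 * m).-1 %% 6).+1 = j by lia.
  by have -> : ((j + 6 * m).-1 %/ 6)%N = m by lia.
by apply/esym/eqP; apply: contraNT vN; apply: supp.
Qed.

(* A solution of the linear equations with right-hand side qcol l; it respects the
   formal degrees precisely when the obstructions have degree at most tau. *)
Definition ycol l (s : bool) (i j : nat) : {poly k} :=
  let o := obstruction l in
  let r := qcol l in
  match s, i, j with
  | false, 4%N, 4%N => r 0%N 4%N
  | false, 5%N, 5%N => r 1%N 5%N
  | false, 6%N, 3%N => - o 2%N
  | false, 6%N, 6%N => r 2%N 6%N - r 0%N 6%N
  | false, 7%N, 1%N => r 3%N 1%N - 'X * o 0%N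
  | false, 7%N, 3%N => - o 2%N
  | false, 7%N, 5%N => o 3%N - o 4%N
  | false, 8%N, 2%N => r 0%N 2%N
  | false, 8%N, 5%N => o 3%N
  | true, 6%N, 6%N => - r 0%N 6%N
  | true, 8%N, 2%N => - r 2%N 2%N
  | true, 9%N, 1%N => 'X * o 0%N
  | true, 9%N, 3%N => r 1%N 3%N
  | true, 10%N, 1%N => 'X * o 0%N
  | true, 10%N, 2%N => - ('X * o 1%N)
  | true, 10%N, 4%N => r 3%N 4%N
  | true, 10%N, 5%N => o 4%N - o 3%N
  | _, _, _ => 0
  end.

Lemma linear_part_ycol l (i : 'I_5) j : (0 < j <= 6)%N ->
  tnth (linear_part (ycol l ltr_g ^~ j) (ycol l ltr_f ^~ j)) i = qcol l i j.
Proof.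
case: l => a b p q c d e u w y z; case: j => [|[|[|[|[|[|[|j]]]]]]] // _.
all: rewrite (tnth_nth 0); case: i => [[|[|[|[|[|i]]]]] hi] //=.
all: rewrite /obstruction /W_lhs /=; ring.
Qed.

(** The bounds that the formal degrees impose on the letters. The sharper bound on [pu] and [pw]
    comes from [g_4^{(5)}] and [g_5^{(6)}], the vanishing constant terms from
    [g_41 = g_42 = g_46 = 0]. *)
Record good l : Prop := Good {
  size_pa : (size (pa l) <= tau.+1)%N; size_pb : (size (pb l) <= tau.+1)%N;
  size_pp : (size (pp l) <= tau.+1)%N; size_pq : (size (pq l) <= tau.+1)%N;
  size_pc : (size (pc l) <= tau.+1)%N; size_pd : (size (pd l) <= tau.+1)%N;
  size_pe : (size (pe l) <= tau.+1)%N; size_pu : (size (pu l) <= tau.-1.+1)%N;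
  size_pw : (size (pw l) <= tau.-1.+1)%N; size_py : (size (py l) <= tau.+1)%N;
  size_pz : (size (pz l) <= tau.+1)%N;
  pa_low : (pa l)`_0 = 0; pp_low : (pp l)`_0 = 0; pw_low : (pw l)`_0 = 0 }.

Definition unobstructed l : Prop :=
  forall n, (n < 5)%N -> (size (obstruction l n) <= tau.+1)%N.

Lemma mem_coefs_entry s i j m : (s, i, j) \in partials -> (0 < j <= 6)%N ->
  (j + 6 * m <= formal_degree tau (s, i, j))%N ->
  (s, i, j + 6 * m)%N \notin [:: (ltr_g, 4, 1); (ltr_g, 4, 2); (ltr_g, 4, 6)]%N ->
  (s, i, j + 6 * m)%N \in coefs tau.
Proof. by move=> sij j16 fd ex; rewrite mem_coefs // sij fd. Qed.

Ltac entry B :=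
  let nz := fresh "nz" in move=> nz;
  match type of nz with is_true (nth _ _ ?m != 0) =>
    have ?: (m <= B)%N; [apply: coef_neq0_size nz; size_bound|];
    apply: mem_coefs_entry;
    [by [] | by [] | rewrite /formal_degree /=; lia
    | rewrite !inE !xpair_eqE /=; lia]
  end.

Local Arguments obstruction : simpl never.

(** The columns of formal degree [i + 12 tau] have room for the products placed there: degree
    [2 tau + 1] for [i] at least 7, and [2 tau] for [i] at most 6, where a factor ['X] always comes
    with [u] or [w]. All other nonzero columns contain only obstructions. *)
Lemma supported_ycol l : good l -> unobstructed l -> supported (ycol l).
Proof.
move=> gl uo s i j m; move: gl uo.
case: l => a b p q c d e u w y z [/= sa sb sp sq sc sd se su sw sy sz _ _ _] uo.
have o0 := uo 0%N isT; have o1 := uo 1%N isT; have o2 := uo 2%N isT.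
have o3 := uo 3%N isT; have o4 := uo 4%N isT.
case: j => [|[|[|[|[|[|[|j]]]]]]] // _.
all: case: s; case: i => [|[|[|[|[|[|[|[|[|[|[|i]]]]]]]]]]]; rewrite /= ?coef0 ?eqxx //.
(* The bounds are the degrees in [t^6] allowed by the formal degrees [j + 6 tau], [j + 6 (tau + 1)],
   and [i + 12 tau] for small and large [i]. *)
all: first [entry tau | entry tau.+1 | entry (2 * tau)%N | entry (2 * tau).+1].
Qed.

Lemma supported_tcol l : good l -> supported (tcol l).
Proof.
case: l => a b p q c d e u w y z [/= sa sb sp sq sc sd se su sw sy sz a0 p0 w0] s i j m.
case: j => [|[|[|[|[|[|[|j]]]]]]] // _.
all: case: s; case: i => [|[|[|[|[|[|[|[|[|[|[|i]]]]]]]]]]]; rewrite /= ?coef0 ?eqxx //.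
(* The three excluded coefficients sit at [m = 0], where the letters concerned have zero constant
   term. *)
all: case: (posnP m) => [->|m0]; rewrite ?coefN ?a0 ?p0 ?w0 ?oppr0 ?eqxx // -?coefN.
all: first [entry tau | entry tau.-1].
Qed.

Definition params_of (c : bool -> nat -> nat -> {poly k}) : params k :=
  Params (c ltr_f 6 1) (c ltr_f 9 1) (c ltr_g 8 2) (c ltr_f 10 2) (c ltr_f 6 3)
    (c ltr_f 8 4) (c ltr_f 10 4) (c ltr_f 10 5) (c ltr_g 5 6) (c ltr_f 8 6)
    (c ltr_f 9 6).

Lemma addr_eq00 (p q : {poly k}) : p = 0 -> q = 0 -> p + q = 0.
Proof. by move=> -> ->; rewrite addr0. Qed.

Lemma subr_eq00 (p q : {poly k}) : p = 0 -> q = 0 -> p - q = 0.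
Proof. by move=> -> ->; rewrite subr0. Qed.

(** The difference of the two sides of the goal is, by [ring], the left-hand side of the combination
    [t] of the equations. *)
Ltac linear_comb t :=
  match type of t with ?e = _ =>
    apply: subr0_eq; transitivity e; [ring | exact: t]
  end.

(** For each residue the absent columns drop out, and suitable combinations of the five equations
    express the remaining columns by the letters. *)
Lemma linear_part_solve (c : bool -> nat -> nat -> {poly k}) :
    (forall s i j, (s, i, j) \notin partials -> (0 < j <= 6)%N -> c s i j = 0) ->
    (forall (i : 'I_5) j, (0 < j <= 6)%N ->
       tnth (linear_part (c ltr_g ^~ j) (c ltr_f ^~ j)) i = 0) ->
  forall s i j, (0 < j <= 6)%N -> c s i j = tcol (params_of c) s i j.
Proof.
move=> c_out T s i j j16; have [|sij] := boolP ((s, i, j) \in partials); last first.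
  rewrite c_out //; move: sij; case: j j16 => [|[|[|[|[|[|[|j]]]]]]] // _;
    by case: s; case: i => [|[|[|[|[|[|[|[|[|[|[|i]]]]]]]]]]].
have E n (n5 : (n < 5)%N) := T (Ordinal n5) j j16.
have e0 := E 0%N isT; have e1 := E 1%N isT; have e2 := E 2%N isT.
have e3 := E 3%N isT; have e4 := E 4%N isT.
move: {E T} e0 e1 e2 e3 e4; rewrite !(tnth_nth 0) /=.
have out a b : (a, b, j) \notin partials -> c a b j = 0 by move=> abj; rewrite c_out.
rewrite /ltr_f /ltr_g; case: j j16 out => [|[|[|[|[|[|[|j]]]]]]] // _ out.
- rewrite (out false 8%N) // (out true 8%N) // => e0 e1 e2 e3 e4.
  case: s; case: i => [|[|[|[|[|[|[|[|[|[|[|i]]]]]]]]]]] //= _.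
  + linear_comb e4.
  + linear_comb e0.
  + linear_comb e1.
  + linear_comb e2.
  + linear_comb (subr_eq00 e3 e4).
- rewrite (out true 6%N) // (out true 9%N) // => e0 e1 e2 e3 e4.
  case: s; case: i => [|[|[|[|[|[|[|[|[|[|[|i]]]]]]]]]]] //= _.
  + linear_comb (subr_eq00 (erefl 0) e4).
  + linear_comb e0.
  + linear_comb e1.
  + linear_comb (subr_eq00 e2 e4).
  + linear_comb (subr_eq00 e3 e4).
- rewrite (out false 4%N) // (out true 8%N) // (out true 10%N) // => e0 e1 e2 e3 e4.
  case: s; case: i => [|[|[|[|[|[|[|[|[|[|[|i]]]]]]]]]]] //= _.
  + linear_comb (subr_eq00 e0 e4).
  + linear_comb (addr_eq00 e1 (subr_eq00 e4 e0)).
  + linear_comb (addr_eq00 e2 (subr_eq00 e4 e0)).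
  + linear_comb e3.
  + linear_comb e0.
- rewrite (out false 5%N) // (out true 9%N) // => e0 e1 e2 e3 e4.
  case: s; case: i => [|[|[|[|[|[|[|[|[|[|[|i]]]]]]]]]]] //= _.
  + linear_comb (subr_eq00 (erefl 0) e1).
  + linear_comb (subr_eq00 (subr_eq00 e0 e1) e4).
  + linear_comb (subr_eq00 e2 e1).
  + linear_comb e3.
  + linear_comb e4.
- rewrite (out false 6%N) // (out true 6%N) // (out true 9%N) // => e0 e1 e2 e3 e4.
  case: s; case: i => [|[|[|[|[|[|[|[|[|[|[|i]]]]]]]]]]] //= _.
  + linear_comb (subr_eq00 (erefl 0) e2).
  + linear_comb (addr_eq00 (subr_eq00 e0 e4) e2).
  + linear_comb e1.
  + linear_comb (subr_eq00 e3 e2).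
  + linear_comb (subr_eq00 e4 e2).
- rewrite (out false 7%N) // => e0 e1 e2 e3 e4.
  case: s; case: i => [|[|[|[|[|[|[|[|[|[|[|i]]]]]]]]]]] //= _.
  + linear_comb (subr_eq00 (erefl 0) e1).
  + linear_comb e3.
  + linear_comb (subr_eq00 (subr_eq00 e0 e1) (subr_eq00 e4 e3)).
  + linear_comb (subr_eq00 e2 e1).
  + linear_comb (subr_eq00 e4 e3).
Qed.

Lemma column_tcol x : T_H x ->
  forall s i j, (0 < j <= 6)%N -> column x s i j = tcol (params_of (column x)) s i j.
Proof.
move=> /T_H_column T; apply: linear_part_solve T => s i j; exact: column_out.
Qed.

Lemma size_column x s i j N :
  (0 < j <= 6)%N -> (formal_degree tau (s, i, j) < j + 6 * N.+1)%N ->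
  (size (column x s i j) <= N.+1)%N.
Proof.
move=> j16 fd; apply/leq_sizeP => m Nm; rewrite coef_column // value_out //.
by rewrite mem_coefs //; apply/and3P => -[_ /leq_ltn_trans/(_ fd)]; lia.
Qed.

Ltac column_bound := apply: size_column => //; rewrite /formal_degree /=; lia.

(** A letter whose own column has too large a formal degree gets its bound through a linear relation
    with smaller columns; for instance [f_9^{(1)} = f_6^{(1)} - g_5^{(1)}]. *)
Lemma good_params x : T_H x -> good (params_of (column x)).
Proof.
move=> T; have eq s i j (j16 : (0 < j <= 6)%N) := column_tcol T s i j16.
have low j : j \in [:: 1; 2; 6]%N -> (column x ltr_g 4 j)`_0 = 0.
  move=> j_in; have j16 : (0 < j <= 6)%N by move: j j_in; apply/allP.
  rewrite coef_column // value_out // mem_coefs // muln0 addn0.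
  by move: j_in; rewrite !inE => /or3P[] /eqP ->; rewrite !andbF.
have sa : (size (column x ltr_f 6 1) <= tau.+1)%N by column_bound.
have sc : (size (column x ltr_f 6 3) <= tau.+1)%N by column_bound.
have sd : (size (column x ltr_f 8 4) <= tau.+1)%N by column_bound.
have sy : (size (column x ltr_f 8 6) <= tau.+1)%N by column_bound.
have sz9 : (size (column x ltr_f 9 6) <= tau.+1)%N by column_bound.
have sw : (size (column x ltr_g 5 6) <= tau.-1.+1)%N by column_bound.
have sg45 : (size (column x ltr_g 4 5) <= tau.-1.+1)%N by column_bound.
have sg51 : (size (column x ltr_g 5 1) <= tau.+1)%N by column_bound.
have sg42 : (size (column x ltr_g 4 2) <= tau.+1)%N by column_bound.
have sg62 : (size (column x ltr_g 6 2) <= tau.+1)%N by column_bound.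
have sg74 : (size (column x ltr_g 7 4) <= tau.+1)%N by column_bound.
have pE : column x ltr_g 8 2 = - column x ltr_g 4 2 by rewrite (eq ltr_g 4%N) //= opprK.
split=> //=.
- have -> : column x ltr_f 9 1 = column x ltr_f 6 1 - column x ltr_g 5 1.
    by rewrite (eq ltr_g 5%N) //=; ring.
  size_bound.
- rewrite pE; size_bound.
- have -> : column x ltr_f 10 2 = column x ltr_g 6 2 + column x ltr_g 4 2.
    by rewrite (eq ltr_g 6%N) //= (eq ltr_g 4%N) //=; ring.
  size_bound.
- have -> : column x ltr_f 10 4 = column x ltr_f 8 4 - column x ltr_g 7 4.
    by rewrite (eq ltr_g 7%N) //=; ring.
  size_bound.
- by have <- : column x ltr_g 4 5 = column x ltr_f 10 5 by rewrite (eq ltr_g 4%N).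
- have <- : column x ltr_g 4 1 = column x ltr_f 6 1 by rewrite (eq ltr_g 4%N).
  exact: low.
- by rewrite pE coefN low ?oppr0.
- have <- : column x ltr_g 4 6 = column x ltr_g 5 6 by rewrite (eq ltr_g 4%N).
  exact: low.
Qed.

Lemma quadratic_part_column x (i : 'I_5) : T_H x ->
  tnth (quadratic_part (joined (column x) ltr_g) (joined (column x) ltr_f)
          (shifted (column x) ltr_g) (shifted (column x) ltr_f)) i =
  assemble (qcol (params_of (column x)) i).
Proof.
move=> T; rewrite -quadratic_part_tcol.
apply: (@quadratic_part_map _ _ idfun) => [a _|a _|a j j16|a j j16] /=.
- by apply/assemble_inj => j; apply: column_tcol.
- by apply/assemble_inj => j; apply: column_tcol.
- by rewrite /shifted column_tcol.
- by rewrite /shifted column_tcol.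
Qed.

Lemma size_mulX_le (p : {poly k}) N : (size ('X * p)%R <= N.+2)%N -> (size p <= N.+1)%N.
Proof.
move=> /leq_sizeP Xp; apply/leq_sizeP => m Nm.
by have := Xp m.+1 Nm; rewrite coefXM.
Qed.

(** Each obstruction, possibly times ['X] or up to sign, is a combination of right-hand sides for
    which only columns of small formal degree survive on the left. *)
Lemma unobstructed_of_solution x y :
    (forall (i : 'I_5) j, (0 < j <= 6)%N ->
      tnth (linear_part (column y ltr_g ^~ j) (column y ltr_f ^~ j)) i =
      qcol (params_of (column x)) i j) ->
  unobstructed (params_of (column x)).
Proof.
move: (params_of (column x)) => l yE.
have E n j (n5 : (n < 5)%N) (j16 : (0 < j <= 6)%N) := yE (Ordinal n5) j j16.
have e11 := E 1%N 1%N isT isT; have e22 := E 2%N 2%N isT isT.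
have e32 := E 3%N 2%N isT isT; have e33 := E 3%N 3%N isT isT.
have e05 := E 0%N 5%N isT isT; have e45 := E 4%N 5%N isT isT.
move: {E yE} e11 e22 e32 e33 e05 e45; rewrite !(tnth_nth 0) /=.
move=> e11 e22 e32 e33 e05 e45.
have s51 : (size (column y ltr_g 5 1) <= tau.+2)%N by column_bound.
have s61 : (size (column y ltr_f 6 1) <= tau.+2)%N by column_bound.
have s91 : (size (column y ltr_f 9 1) <= tau.+2)%N by column_bound.
have sg62 : (size (column y ltr_g 6 2) <= tau.+2)%N by column_bound.
have sf62 : (size (column y ltr_f 6 2) <= tau.+2)%N by column_bound.
have s92 : (size (column y ltr_f 9 2) <= tau.+2)%N by column_bound.
have s72 : (size (column y ltr_g 7 2) <= tau.+2)%N by column_bound.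
have s102 : (size (column y ltr_f 10 2) <= tau.+2)%N by column_bound.
have s73 : (size (column y ltr_g 7 3) <= tau.+1)%N by column_bound.
have s83 : (size (column y ltr_f 8 3) <= tau.+1)%N by column_bound.
have s103 : (size (column y ltr_f 10 3) <= tau.+1)%N by column_bound.
have s45 : (size (column y ltr_g 4 5) <= tau.+1)%N by column_bound.
have s65 : (size (column y ltr_f 6 5) <= tau.+1)%N by column_bound.
have sg85 : (size (column y ltr_g 8 5) <= tau.+1)%N by column_bound.
have sf85 : (size (column y ltr_f 8 5) <= tau.+1)%N by column_bound.
have s95 : (size (column y ltr_f 9 5) <= tau.+1)%N by column_bound.
have s105 : (size (column y ltr_f 10 5) <= tau.+1)%N by column_bound.
move: s51 s61 s91 sg62 sf62 s92 s72 s102 s73 s83 s103 s45 s65 sg85 sf85 s95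
  s105 e11 e22 e32 e33 e05 e45.
move: (column y) => c s51 s61 s91 sg62 sf62 s92 s72 s102 s73 s83 s103 s45 s65 sg85 sf85 s95
  s105 e11 e22 e32 e33 e05 e45.
case=> [|[|[|[|[|n]]]]] // _.
- apply: size_mulX_le; have <- : qcol l 1 1 = 'X * obstruction l 0 by case: (l).
  rewrite -e11; size_bound.
- apply: size_mulX_le.
  have -> : 'X * obstruction l 1 = qcol l 2 2 - qcol l 3 2.
    by case: (l) => *; rewrite /obstruction /W_lhs /=; ring.
  rewrite -e22 -e32.
  (* Subtracting the two equations cancels [f_8^{(2)}], whose formal degree [8 + 12 tau] would spoil
     the bound. *)
  have -> : c ltr_g 6 2 - c ltr_f 6 2 - c ltr_f 8 2
      + c ltr_f 9 2
      - (c ltr_g 7 2 - c ltr_f 8 2 + c ltr_f 10 2) =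
    c ltr_g 6 2 - c ltr_f 6 2 + c ltr_f 9 2 - c ltr_g 7 2
      - c ltr_f 10 2 by ring.
  size_bound.
- have -> : obstruction l 2 = - qcol l 3 3 by case: (l) => *; rewrite /= opprK.
  rewrite -e33; size_bound.
- have -> : obstruction l 3 = qcol l 0 5.
    by case: (l) => *; rewrite /obstruction /W_lhs /=; ring.
  rewrite -e05; size_bound.
- have -> : obstruction l 4 = qcol l 4 5.
    by case: (l) => *; rewrite /obstruction /W_lhs /=; ring.
  rewrite -e45; size_bound.
Qed.

Lemma Q_H_params (E : elimination k tau) x :
  Q_H E x <-> T_H x /\ unobstructed (params_of (column x)).
Proof.
rewrite Q_H_char; split=> -[T h]; split=> //.
  case: h => y /equations_column hy; apply: (@unobstructed_of_solution x y) => i.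
  by apply/assemble_inj; rewrite hy quadratic_part_column.
have supp := supported_ycol (good_params T) h.
(* Without obstruction, [ycol] respects the formal degrees and is an explicit preimage of the
   quadratic part. *)
exists (point (ycol (params_of (column x)))); apply/equations_column => i.
rewrite quadratic_part_column //; apply/assemble_inj => j j16.
rewrite -linear_part_ycol //.
by apply: (@linear_part_map _ _ idfun) => a _ /=; rewrite column_point.
Qed.

End Solutions.

(** * The cone W *)

Lemma W_lhs_map (R R' : nzRingType) (h : {rmorphism R -> R'}) (o : nat -> R) n :
  h (W_lhs o n) = W_lhs (h \o o) n.
Proof. by case: n => [|[|[|[|n]]]]; rewrite /= ?(rmorphD, rmorphN, rmorphM). Qed.

Section WCone.
Variables (k : fieldType) (tau : nat).
Hypothesis tau0 : (0 < tau)%N.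

(* Reversal turns the top coefficients of p * q into the low coefficients of P * Q,
   that is, into a product in k[eps]. *)
Lemma coefM_rev (p q P Q : {poly k}) N n :
    (size p <= N.+1)%N -> (size q <= N.+1)%N -> (n < N)%N ->
    (forall j, (j < N)%N -> P`_j = p`_(N - j)) ->
    (forall j, (j < N)%N -> Q`_j = q`_(N - j)) ->
  (P * Q)`_n = (p * q)`_(2 * N - n).
Proof.
move=> /leq_sizeP sp /leq_sizeP sq nN hP hQ; rewrite !coefM.
rewrite -(big_mkord xpredT (fun i => P`_i * Q`_(n - i))) big_nat_rev /=.
rewrite -(big_mkord xpredT (fun i => p`_i * q`_(2 * N - n - i))).
rewrite [RHS](big_cat_nat (n := (N - n)%N)) /=; [|lia..].
rewrite [X in _ = X + _]big_nat [X in _ = X + _]big1 ?add0r; last first.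
  by move=> i iN; rewrite sq ?mulr0 //; lia.
rewrite [RHS](big_cat_nat (n := N.+1)) /=; [|lia..].
rewrite [X in _ = _ + X]big_nat [X in _ = _ + X]big1 ?addr0; last first.
  by move=> i iN; rewrite sp ?mul0r //; lia.
rewrite -[in RHS](add0n (N - n)%N) big_addn.
have -> : (N.+1 - (N - n) = n.+1)%N by lia.
rewrite big_nat [RHS]big_nat; apply: eq_bigr => i /andP[_ i_n].
rewrite hP ?hQ; [|lia..].
by congr (p`_ _ * q`_ _); lia.
Qed.

Lemma in_qpoly_Xn_eq0 (p : {poly k}) :
  in_qpoly 'X^tau p = 0 <-> forall m, (m < tau)%N -> p`_m = 0.
Proof.
have E : (in_qpoly 'X^tau p : {poly k}) = take_poly tau p.
  (* The modulus is stored as ['X^tau.-1.+1], which is ['X^tau] because [tau] is positive. *)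
  by rewrite /= mk_monic_Xn prednK // Pdiv.RingMonic.take_poly_rmodp.
split=> [p0 m mt|p0].
  have := congr1 (fun q : {poly %/ 'X^tau} => (q : {poly k})`_m) p0.
  by rewrite E coef_take_poly mt coef0.
apply: val_inj; rewrite [LHS]E; apply/polyP => m.
by rewrite coef_take_poly coef0; case: ifP => // /p0.
Qed.

Lemma size_om (l : params k) i : good tau l -> (size ((om l)`_i)%R <= tau.+1)%N.
Proof.
case: l => a b p q c d e u w y z [/= *].
case: i => [|[|[|[|[|[|[|[|[|[|i]]]]]]]]]]; rewrite /= ?nth_nil ?size_poly0 //.
all: size_bound.
Qed.

Lemma size_obstruction (l : params k) n : good tau l ->
  (size (obstruction l n) <= (2 * tau).+1)%N.
Proof.
move=> gl; have s0 := size_om 0 gl; have s1 := size_om 1 gl.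
have s2 := size_om 2 gl; have s3 := size_om 3 gl; have s4 := size_om 4 gl.
have s5 := size_om 5 gl; have s6 := size_om 6 gl; have s7 := size_om 7 gl.
have s8 := size_om 8 gl; have s9 := size_om 9 gl.
by rewrite /obstruction; case: n => [|[|[|[|n]]]] /=; size_bound.
Qed.

(** By reversal, the coefficient of [eps^m] in an equation of [W] is the coefficient of index
    [2 tau - m] of the obstruction. For [m < tau] these are all the indices from [tau + 1] to
    [2 tau], and nothing lies above. *)
Lemma W_cone_unobstructed (l : params k) (w : 'I_10 * 'I_tau -> k) :
    good tau l -> (forall i j, w (i, j) = ((om l)`_i)`_(tau - j)) ->
  W_cone w <-> unobstructed tau l.
Proof.
move=> gl wE.
pose O i : {poly k} := \sum_(j < tau) w (inord i.-1, j) *: 'X^j.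
have omE i : omega w i = in_qpoly 'X^tau (O i).
  rewrite /omega /O linear_sum; apply: eq_bigr => j _.
  by rewrite linearZ /= rmorphXn.
have OE i j : (i.-1 < 10)%N -> (j < tau)%N -> (O i)`_j = ((om l)`_i.-1)`_(tau - j).
  move=> i10 jt; rewrite coef_sum (bigD1 (Ordinal jt)) //= coefZ coefXn eqxx mulr1.
  rewrite big1 ?addr0 ?wE ?inordK // => j' jj'; rewrite coefZ coefXn.
  by case: eqP => [jE|_]; rewrite ?mulr0 //; case/eqP: jj'; apply: val_inj.
have lhsE n : W_lhs (omega w) n = in_qpoly 'X^tau (W_lhs O n).
  rewrite (W_lhs_map (in_qpoly 'X^tau)).
  by case: n => [|[|[|[|n]]]]; rewrite /W_lhs !omE.
have coefE n m : (m < tau)%N -> (W_lhs O n)`_m = (obstruction l n)`_(2 * tau - m).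
  have M i j : (i.-1 < 10)%N -> (j.-1 < 10)%N -> (m < tau)%N ->
      (O i * O j)`_m = ((om l)`_i.-1 * (om l)`_j.-1)`_(2 * tau - m).
    by move=> i10 j10 mt; apply: coefM_rev => // *; [apply: size_om..|apply: OE|apply: OE].
  move=> mt; rewrite /obstruction.
  by case: n => [|[|[|[|n]]]]; rewrite /W_lhs !(coefD, coefN) !M.
have eqE n : W_lhs (omega w) n = 0 <-> (size (obstruction l n) <= tau.+1)%N.
  rewrite lhsE in_qpoly_Xn_eq0; split=> [h|/leq_sizeP h m mt].
    apply/leq_sizeP => m mt; have [mbig|msmall] := leqP (2 * tau).+1 m.
      by rewrite nth_default // (leq_trans (size_obstruction n gl)).
    have -> : m = (2 * tau - (2 * tau - m))%N by lia.
    by rewrite -coefE ?h //; lia.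
  by rewrite coefE // h //; lia.
split=> [[h0 h1 h2 h3 h4]|uo].
  by case=> [|[|[|[|[|n]]]]] // _; apply/eqE.
by split; [apply: (proj2 (eqE 0%N)) | apply: (proj2 (eqE 1%N)) | apply: (proj2 (eqE 2%N))
  | apply: (proj2 (eqE 3%N)) | apply: (proj2 (eqE 4%N))]; apply: uo.
Qed.

End WCone.

(** * Coordinates on V and W versus letters *)

Section Coordinates.
Variables (k : fieldType) (tau : nat).
Hypothesis tau0 : (0 < tau)%N.
Implicit Types (v : {ffun VW_ix tau -> k}) (l : params k).

(** [V] takes the constant terms of the entries of [om] that are not determined otherwise, and the
    coefficients of [z] below [tau]. The constant terms of [a], [p] and ['X * u] are zero, and that
    of [w - z] is minus that of [z]. *)
Definition vw_val l (c : VW_ix tau) : k :=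
  match c with
  | inl (inl i) => nth 0 [:: (pb l)`_0; (pq l)`_0; (pc l)`_0; (pd l)`_0;
                             (pe l - pd l)`_0; (py l - pz l)`_0] i
  | inl (inr i) => (pz l)`_i
  | inr (i, j) => ((om l)`_i)`_(tau - j)
  end.

Definition vw_of l : {ffun VW_ix tau -> k} := [ffun c => vw_val l c].

Definition w_coord v (i n : nat) : k :=
  if insub n is Some j then v (inr (inord i, j)) else 0.
Definition z_coord v (n : nat) : k :=
  if insub n is Some j then v (inl (inr j)) else 0.
Definition v_coord v (i : nat) : k := v (inl (inl (inord i))).

Definition letter v i (v0 : k) : {poly k} :=
  \poly_(m < tau.+1) (if m == 0%N then v0 else w_coord v i (tau - m)).

(** The top coefficient is not a coordinate of [V]: as [w] has degree below [tau], it is minus the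
    top coefficient of [w - z], that is [- w_{10,0}]. *)
Definition z_letter v : {poly k} :=
  \poly_(m < tau.+1) (if (m < tau)%N then z_coord v m else - w_coord v 9 0).

Definition params_of_vw v : params k :=
  let d := letter v 5 (v_coord v 3) in
  let z := z_letter v in
  Params (letter v 0 0) (letter v 1 (v_coord v 0)) (letter v 2 0)
    (letter v 3 (v_coord v 1)) (letter v 4 (v_coord v 2)) d
    (letter v 6 (v_coord v 4) + d) (\poly_(m < tau) w_coord v 7 (tau - m.+1))
    (letter v 9 (- z_coord v 0) + z) (letter v 8 (v_coord v 5) + z) z.

Lemma coef_letter v i (v0 : k) m : (letter v i v0)`_m =
  if m == 0%N then v0 else if (m <= tau)%N then w_coord v i (tau - m) else 0.
Proof. by rewrite coef_poly ltnS; case: m => [|m] //=. Qed.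

Lemma coef_z_letter v m : (z_letter v)`_m =
  if (m < tau)%N then z_coord v m else if m == tau then - w_coord v 9 0 else 0.
Proof.
rewrite coef_poly ltnS leq_eqVlt; case: (ltnP m tau) => mt; rewrite ?orbT // orbF.
by case: eqP.
Qed.

Lemma w_coordE v i (j : 'I_tau) : w_coord v i j = v (inr (inord i, j)).
Proof. by rewrite /w_coord insubT // => jt; congr (v (inr (_, _))); apply: val_inj. Qed.

Lemma z_coordE v (j : 'I_tau) : z_coord v j = v (inl (inr j)).
Proof. by rewrite /z_coord insubT // => jt; congr (v (inl (inr _))); apply: val_inj. Qed.

Lemma params_of_vwK v : vw_of (params_of_vw v) = v.
Proof.
apply/ffunP => -[[i|i]|[i j]]; rewrite ffunE.
- rewrite -[in RHS](inord_val i); case: i => [[|[|[|[|[|[|i]]]]]] hi] //=;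
    by rewrite ?coefB ?coefD ?coef_letter ?addrK.
- by rewrite /= coef_z_letter ltn_ord z_coordE.
have jt := ltn_ord j; have tj : (tau - (tau - j))%N = j by lia.
have tj0 : (tau - j == 0)%N = false by lia.
rewrite -[in RHS](inord_val i).
case: i => [[|[|[|[|[|[|[|[|[|[|i]]]]]]]]]] hi] //=.
all: rewrite ?coefXM ?coefB ?coefD ?addrK ?coef_letter ?tj0 ?leq_subr ?tj ?w_coordE //.
rewrite coef_poly prednK; last by lia.
by rewrite leq_subr tj w_coordE.
Qed.

Lemma good_params_of_vw v : good tau (params_of_vw v).
Proof.
have sl i (v0 : k) : (size (letter v i v0) <= tau.+1)%N by exact: size_poly.
have sz : (size (z_letter v) <= tau.+1)%N by exact: size_poly.
have sD (p q : {poly k}) :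
    (size p <= tau.+1)%N -> (size q <= tau.+1)%N -> (size (p + q)%R <= tau.+1)%N.
  by move=> sp sq; rewrite (leq_trans (size_polyD _ _)) // geq_max sp.
split; rewrite /= ?coefD ?coef_letter ?coef_z_letter ?tau0 ?addNr //.
- exact: sD.
- by rewrite prednK // size_poly.
(* The coefficients of index [tau] of [w - z] and [z] cancel in [w]. *)
- rewrite prednK //; apply/leq_sizeP => m tm.
  rewrite coefD coef_letter coef_z_letter ltnNge tm /= (gtn_eqF (leq_trans tau0 tm)).
  case: eqP => [->|/eqP mt]; first by rewrite leqnn subnn subrr.
  by rewrite leqNgt ltn_neqAle eq_sym mt tm addr0.
- exact: sD.
Qed.

Lemma vw_ofK l : good tau l -> params_of_vw (vw_of l) = l.
Proof.
move=> gl; have wE i m : (i < 10)%N -> (0 < m <= tau)%N ->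
    w_coord (vw_of l) i (tau - m) = ((om l)`_i)`_m.
  move=> i10 m_tau; have jt : (tau - m < tau)%N by lia.
  rewrite (_ : (tau - m)%N = Ordinal jt) // w_coordE ffunE /vw_val inordK //=.
  by congr (_`_ _); lia.
have zE m : (m < tau)%N -> z_coord (vw_of l) m = (pz l)`_m.
  by move=> mt; rewrite (_ : m = Ordinal mt) // z_coordE ffunE.
have letterE i (v0 : k) : (i < 10)%N -> ((om l)`_i)`_0 = v0 ->
    letter (vw_of l) i v0 = (om l)`_i.
  move=> i10 i0; apply/polyP => m; rewrite coef_letter.
  case: posnP => [->//|m0]; case: leqP => mt; first by rewrite wE ?m0.
  by rewrite nth_default // (leq_trans (size_om tau0 i gl)).
have vE i : (i < 6)%N -> v_coord (vw_of l) i =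
    [:: (pb l)`_0; (pq l)`_0; (pc l)`_0; (pd l)`_0; (pe l - pd l)`_0; (py l - pz l)`_0]`_i.
  by move=> i6; rewrite /v_coord ffunE /vw_val inordK.
have zlE : z_letter (vw_of l) = pz l.
  apply/polyP => m; rewrite coef_z_letter.
  case: ltngtP => [/zE //|mt|->].
    by rewrite nth_default // (leq_trans (size_pz gl)).
  have := wE 9%N tau isT; rewrite tau0 leqnn subnn => -> //.
  have : (pw l)`_tau = 0 by rewrite nth_default // (leq_trans (size_pw gl)) ?prednK.
  by case: (l) => a b p q c d e u w y z /= w0; rewrite coefB w0 sub0r opprK.
rewrite /params_of_vw zlE !vE // zE //=.
have u_E : \poly_(m < tau) w_coord (vw_of l) 7 (tau - m.+1) = pu l.
  apply/polyP => m; rewrite coef_poly; case: ltnP => mt.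
    by rewrite wE //; case: (l) => *; rewrite /= coefXM.
  by rewrite nth_default // (leq_trans (size_pu gl)) // prednK.
rewrite u_E; case: l gl {wE zE vE zlE u_E} letterE.
move=> a b p q c d e u w y z [/= _ _ _ _ _ _ _ _ _ _ _ a0 p0 w0] letterE.
rewrite !letterE //=; last by rewrite coefB w0 sub0r.
by rewrite !subrK.
Qed.

Lemma params_of_point l : good tau l ->
  params_of (column (point tau (tcol l))) = l.
Proof.
move=> gl; have col := column_point tau0 (supported_tcol tau0 gl).
by rewrite /params_of !col //; case: (l).
Qed.

Lemma T_H_point l : good tau l -> T_H (point tau (tcol l)).
Proof.
move=> gl; have col := column_point tau0 (supported_tcol tau0 gl).
apply/T_H_column => i j j16; rewrite -(linear_part_tcol l i j16).
by apply: (@linear_part_map _ _ idfun) => a _ /=; rewrite col.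
Qed.

Lemma point_column (x : {ffun coef tau -> k}) (c : bool -> nat -> nat -> {poly k}) :
    (forall s i j, (0 < j <= 6)%N -> c s i j = column x s i j) ->
  point tau c = x.
Proof.
move=> cE; apply/ffunP => v; rewrite ffunE.
have := coef_deg_gt0 v; rewrite /coef_deg; case vE: (ssval v) => [[s i] r] /= r0.
rewrite cE ?ltn_mod // coef_column ?ltn_mod //.
have -> : ((r.-1 %% 6).+1 + 6 * (r.-1 %/ 6) = r)%N by lia.
by rewrite -vE /value valK.
Qed.
End Coordinates.

(** * Linear maps respecting the weights *)

Section GradedLinear.
Variable k : fieldType.

(** A linear form in the coordinates of weight [d] only, phrased for functions so that it can be
    checked on coefficients of columns without exhibiting a polynomial. *)
Definition graded_form (I : finType) (wt : I -> int) (d : int)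
    (F : {ffun I -> k} -> k) : Prop :=
  (forall (a : k) (x y : {ffun I -> k}), F [ffun i => a * x i + y i] = a * F x + F y) /\
  (forall x : {ffun I -> k}, (forall i, wt i = d -> x i = 0) -> F x = 0).

Section Closure.
Variables (I : finType) (wt : I -> int) (d : int).
Implicit Types F G : {ffun I -> k} -> k.

Lemma graded_form0 : graded_form wt d (fun=> 0).
Proof. by split=> // *; rewrite mulr0 addr0. Qed.

Lemma graded_formD F G : graded_form wt d F -> graded_form wt d G ->
  graded_form wt d (fun x => F x + G x).
Proof.
move=> [Fl Fg] [Gl Gg]; split=> [a x y|x x0]; last by rewrite Fg ?Gg ?addr0.
by rewrite Fl Gl; ring.
Qed.

Lemma graded_formN F : graded_form wt d F -> graded_form wt d (fun x => - F x).
Proof.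
move=> [Fl Fg]; split=> [a x y|x x0]; last by rewrite Fg ?oppr0.
by rewrite Fl; ring.
Qed.

Lemma graded_form_coord i : wt i = d -> graded_form wt d (fun x => x i).
Proof. by move=> id; split=> [a x y|x x0]; [rewrite ffunE | apply: x0]. Qed.

Lemma graded_form_eq F G : F =1 G -> graded_form wt d F -> graded_form wt d G.
Proof. by move=> FG [Fl Fg]; split=> [a x y|x x0]; rewrite -!FG; [apply: Fl|apply: Fg]. Qed.

Lemma graded_form_expand F (x : {ffun I -> k}) : graded_form wt d F ->
  F x = \sum_i x i * F [ffun i' => (i' == i)%:R].
Proof.
move=> [Fl Fg]; have F0 : F [ffun=> 0] = 0 by apply: Fg => i _; rewrite ffunE.
have expand s : uniq s -> F [ffun i => if i \in s then x i else 0] =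
    \sum_(i <- s) x i * F [ffun i' => (i' == i)%:R].
  elim: s => [_|i s IH /andP[si us]].
    by rewrite big_nil -[RHS]F0; congr F; apply/ffunP => i; rewrite !ffunE.
  rewrite big_cons -IH // -Fl; congr F; apply/ffunP => i'; rewrite !ffunE inE.
  by have [->|] := eqVneq i' i; rewrite ?(negPf si) ?mulr1 ?mulr0 ?addr0 ?add0r.
rewrite -big_enum /= -expand ?enum_uniq //; congr F.
by apply/ffunP => i; rewrite ffunE mem_enum.
Qed.
End Closure.

(** The polynomials have the values at the basis vectors as coefficients; such a value vanishes
    unless the basis vector has the right weight. *)
Lemma graded_linear_map (I J : finType) (wtI : I -> int) (wtJ : J -> int)
    (F : {ffun I -> k} -> {ffun J -> k}) :
    (forall j, graded_form wtI (wtJ j) (fun x => F x j)) ->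
  exists phi : J -> {mpoly k[#|I|]},
    (forall j, quasi_homogeneous wtI (wtJ j) (phi j)) /\
    (forall x, poly_map phi x = F x).
Proof.
move=> hF; pose delta i : {ffun I -> k} := [ffun i' => (i' == i)%:R].
exists (fun j => \sum_i F (delta i) j *: coord_poly k i); split=> [j m|x].
  rewrite mcoeff_msupp raddf_sum /= => m_neq0.
  have [i Fi] : exists i, (F (delta i) j *: coord_poly k i)@_m != 0.
    apply/existsP; apply: contraNT m_neq0 => /existsPn m0.
    by rewrite big1 // => i _; apply/eqP; move: (m0 i); rewrite negbK.
  move: Fi; rewrite mcoeffZ mcoeffX.
  have [<-|_] := eqVneq U_(enum_rank i)%MM m; last by rewrite mulr0 eqxx.
  rewrite mulr1 => Fi; rewrite (bigD1 i) //= mnm1E eqxx mulr1n big1 ?addr0.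
    apply/eqP; apply: contraNT Fi => wij; apply/eqP; apply: (proj2 (hF j)) => i' i'j.
    by rewrite ffunE; case: eqP => // i'i; rewrite -i'i i'j eqxx in wij.
  by move=> i' i'i; rewrite mnm1E (inj_eq enum_rank_inj) eq_sym (negPf i'i) mulr0n.
apply/ffunP => j; rewrite ffunE /coord_eval raddf_sum /= (graded_form_expand x (hF j)).
by apply: eq_bigr => i _; rewrite mevalZ mevalXU enum_rankK mulrC.
Qed.
End GradedLinear.

(** * The isomorphism *)

Section Isomorphism.
Variables (k : fieldType) (tau : nat).
Hypothesis tau0 : (0 < tau)%N.

Section CoefForms.
Variables (I : finType) (wt : I -> int) (d : int) (m : nat).
Implicit Types p q : {ffun I -> k} -> {poly k}.

Lemma graded_form_coefD p q :
  graded_form wt d (fun x => (p x)`_m) -> graded_form wt d (fun x => (q x)`_m) ->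
  graded_form wt d (fun x => (p x + q x)`_m).
Proof.
by move=> hp hq; apply: graded_form_eq (graded_formD hp hq) => x; rewrite coefD.
Qed.

Lemma graded_form_coefN p :
  graded_form wt d (fun x => (p x)`_m) -> graded_form wt d (fun x => (- p x)`_m).
Proof. by move=> hp; apply: graded_form_eq (graded_formN hp) => x; rewrite coefN. Qed.

Lemma graded_form_coef0 : graded_form wt d (fun=> (0 : {poly k})`_m).
Proof. by apply: graded_form_eq (graded_form0 _ _ _) => x; rewrite coef0. Qed.
End CoefForms.

Lemma graded_value (v : bool * nat * nat) :
  graded_form (@coef_wt tau) (v.2)%:Z (fun x : {ffun coef tau -> k} => value x v).
Proof.
rewrite /value; case: insubP => [c _ cE|_]; last exact: graded_form0.
by apply: graded_form_coord; rewrite /coef_wt cE.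
Qed.

Lemma graded_column s i j m (d : int) : (0 < j <= 6)%N -> d = (j + 6 * m)%N ->
  graded_form (@coef_wt tau) d (fun x : {ffun coef tau -> k} => (column x s i j)`_m).
Proof.
move=> j16 ->; apply: graded_form_eq (graded_value (s, i, j + 6 * m)%N) => x.
by rewrite coef_column.
Qed.

(** For [n] outside the range the coordinate defaults to 0, which is graded of any weight; hence the
    conditional hypothesis. *)
Lemma graded_w_coord i n (d : int) : (i < 10)%N ->
  ((n < tau)%N -> d = nth 0 eta_wt i + 6 * (tau%:Z - n%:Z)) ->
  graded_form (@VW_wt tau) d (fun v : {ffun VW_ix tau -> k} => w_coord v i n).
Proof.
rewrite /w_coord => i10 dE; case: insubP => [j jt jE|_]; last exact: graded_form0.
by apply: graded_form_coord; rewrite dE //= inordK // jE.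
Qed.

Lemma graded_z_coord n (d : int) : d = 6 * n.+1 ->
  graded_form (@VW_wt tau) d (fun v : {ffun VW_ix tau -> k} => z_coord v n).
Proof.
rewrite /z_coord => dE; case: insubP => [j jt jE|_]; last exact: graded_form0.
by apply: graded_form_coord; rewrite dE /= jE.
Qed.

Lemma graded_v_coord i (d : int) : (i < 6)%N -> d = nth 0 [:: 1; 2; 3; 4; 4; 6] i ->
  graded_form (@VW_wt tau) d (fun v : {ffun VW_ix tau -> k} => v_coord v i).
Proof. by move=> i6 ->; apply: graded_form_coord; rewrite /= inordK. Qed.

Lemma graded_letter i (f : {ffun VW_ix tau -> k} -> k) m (d : int) : (i < 10)%N ->
    d = nth 0 eta_wt i + 6 * m%:Z ->
    (m = 0%N -> graded_form (@VW_wt tau) d f) ->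
  graded_form (@VW_wt tau) d (fun v => (letter v i (f v))`_m).
Proof.
move=> i10 dE; case: m dE => [|m] dE hf.
  by apply: graded_form_eq (hf erefl) => v; rewrite coef_letter.
have [mt|mt] := leqP m.+1 tau.
  have : graded_form (@VW_wt tau) d (fun v : {ffun VW_ix tau -> k} => w_coord v i (tau - m.+1)).
    by apply: graded_w_coord => // _; rewrite dE; lia.
  by apply: graded_form_eq => v; rewrite coef_letter mt.
by apply: graded_form_eq (graded_form0 _ _ _) => v; rewrite coef_letter leqNgt mt.
Qed.

Lemma graded_z_letter m (d : int) : d = 6 + 6 * m%:Z ->
  graded_form (@VW_wt tau) d (fun v : {ffun VW_ix tau -> k} => (z_letter v)`_m).
Proof.
move=> dE; case: (ltngtP m tau) => mt.
- have : graded_form (@VW_wt tau) d (fun v : {ffun VW_ix tau -> k} => z_coord v m).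
    by apply: graded_z_coord; rewrite dE; lia.
  by apply: graded_form_eq => v; rewrite coef_z_letter mt.
- apply: graded_form_eq (graded_form0 _ _ _) => v.
  by rewrite coef_z_letter ltnNge (ltnW mt) /= gtn_eqF.
have : graded_form (@VW_wt tau) d (fun v : {ffun VW_ix tau -> k} => - w_coord v 9 0).
  by apply/graded_formN/graded_w_coord => // _; rewrite dE /=; lia.
by apply: graded_form_eq => v; rewrite coef_z_letter mt ltnn eqxx.
Qed.

Lemma graded_u_letter m (d : int) : d = 5 + 6 * m%:Z ->
  graded_form (@VW_wt tau) d (fun v : {ffun VW_ix tau -> k} =>
    (\poly_(m < tau) w_coord v 7 (tau - m.+1))`_m).
Proof.
move=> dE; have [mt|mt] := ltnP m tau.
  have : graded_form (@VW_wt tau) d (fun v : {ffun VW_ix tau -> k} => w_coord v 7 (tau - m.+1)).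
    by apply: graded_w_coord => // _; rewrite dE /=; lia.
  by apply: graded_form_eq => v; rewrite coef_poly mt.
by apply: graded_form_eq (graded_form0 _ _ _) => v; rewrite coef_poly ltnNge mt.
Qed.

Lemma graded_tcol s i j m (d : int) : (0 < j <= 6)%N -> d = (j + 6 * m)%N ->
  graded_form (@VW_wt tau) d
    (fun v : {ffun VW_ix tau -> k} => (tcol (params_of_vw v) s i j)`_m).
Proof.
case: j => [|[|[|[|[|[|[|j]]]]]]] // _ dE.
all: case: s; case: i => [|[|[|[|[|[|[|[|[|[|[|i]]]]]]]]]]]; rewrite /tcol /params_of_vw /=.
all: do ?[apply: graded_form_coefD | apply: graded_form_coefN].
all: try exact: graded_form_coef0.
all: try by [apply: graded_z_letter; lia | apply: graded_u_letter; lia].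
all: apply: graded_letter; [by [] | by rewrite dE /=; lia | move=> m0].
(* The constant terms: zero for [a] and [p], minus that of [z] for [w - z], and a coordinate of [V]
   otherwise. *)
all: first [exact: graded_form0
  | by apply: graded_v_coord => //; rewrite dE m0
  | by apply/graded_formN/graded_z_coord; rewrite dE m0].
Qed.

Lemma graded_vw_of (c : VW_ix tau) : graded_form (@coef_wt tau) (VW_wt c)
  (fun x : {ffun coef tau -> k} => vw_of tau (params_of (column x)) c).
Proof.
apply: (@graded_form_eq _ _ _ _ (fun x => vw_val (params_of (column x)) c)) => [x|].
  by rewrite ffunE.
case: c => [[i|i]|[i j]].
- case: i => [[|[|[|[|[|[|i]]]]]] hi] //=;
    do ?[apply: graded_form_coefD | apply: graded_form_coefN];
    by apply: graded_column.
- by apply: graded_column => //=; lia.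
have jt := ltn_ord j.
case: i => [[|[|[|[|[|[|[|[|[|[|i]]]]]]]]]] hi] //=.
all: do ?[apply: graded_form_coefD | apply: graded_form_coefN].
all: try by apply: graded_column => //; lia.
(* Multiplication by ['X] lowers the index by one, and [5 + 6 (tau - j - 1)] is the weight
   [-1 + 6 (tau - j)] of the eighth family. *)
have uE (x : {ffun coef tau -> k}) : (column x ltr_f 10 5)`_(tau - j).-1 =
    ('X * column x ltr_f 10 5)`_(tau - j) by rewrite coefXM; case: eqP => //; lia.
by apply: graded_form_eq uE _; apply: graded_column => //; lia.
Qed.

Lemma graded_point (c : coef tau) : graded_form (@VW_wt tau) (coef_wt c)
  (fun v : {ffun VW_ix tau -> k} => point tau (tcol (params_of_vw v)) c).
Proof.
have := coef_deg_gt0 c; rewrite /coef_deg /coef_wt.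
case cE: (ssval c) => [[s i] r] /= r0.
apply: (@graded_form_eq _ _ _ _ (fun v =>
  (tcol (params_of_vw v) s i (r.-1 %% 6).+1)`_(r.-1 %/ 6))) => [v|].
  by rewrite ffunE cE.
by apply: graded_tcol; lia.
Qed.

(** Both maps are linear on the ambient spaces. Passing from [VW] coordinates to a point and back is
    the identity everywhere; the other composite is the identity on [T_H]. *)
Lemma Q_H_iso_VW (E : elimination k tau) :
  quasi_cone_iso (@coef_wt tau) (Q_H E) (@VW_wt tau) (@VW k tau).
Proof.
have [phi [phi_h phiE]] := @graded_linear_map k _ _ _ _
  (fun x : {ffun coef tau -> k} => vw_of tau (params_of (column x))) graded_vw_of.
have [psi [psi_h psiE]] := @graded_linear_map k _ _ _ _
  (fun v : {ffun VW_ix tau -> k} => point tau (tcol (params_of_vw v))) graded_point.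
exists phi, psi; split=> // [x|v]; rewrite phiE psiE.
  move=> /(Q_H_params tau0)[Tx ux]; have gx := good_params tau0 Tx.
  split; last rewrite (vw_ofK tau0) //.
    apply: (proj2 (W_cone_unobstructed tau0 gx _)) ux => i j; by rewrite ffunE.
  by apply: (point_column tau0) => s i j j16; rewrite (column_tcol Tx).
move=> Wv; have gv := good_params_of_vw tau0 v.
rewrite (params_of_point tau0) // (params_of_vwK tau0) //; split=> //.
apply/(Q_H_params tau0); rewrite (params_of_point tau0) //; split; first exact: (T_H_point tau0).
apply: (proj1 (W_cone_unobstructed tau0 gv _)) Wv => i j.
by rewrite -[in LHS](params_of_vwK tau0 v) ffunE.
Qed.
End Isomorphism.

(** The first conjunct ensures that the quantification over eliminations is not vacuous. *)
Theorem theorem4p4 (k : closedFieldType) (tau : nat)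
    (hchar2 : 2%N \notin [pchar k]) (hchar3 : 3%N \notin [pchar k])
    (htau : (0 < tau)%N) :
  inhabited (elimination k tau) /\
  forall E : elimination k tau,
    quasi_cone_iso (@coef_wt tau) (Q_H E) (@VW_wt tau) (@VW k tau).
Proof. by split=> [|E]; [apply: elimination_exists | apply: Q_H_iso_VW]. Qed.
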